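(* Let $k\ge 6$ be an integer and let $\alpha\ge \frac{1+\sqrt2}{4}$. Then $$\mathcal{M}_k^{\alpha}<\mu\,\alpha^{1/3}\left(1+\frac{\alpha}{k}\right)^{1/6},$$ where $\mu=\frac{10}{7}$ if $k$ is even and $\mu=22$ if $k$ is odd.
   Context: For $\alpha>-1$, $\mathbf{P}_k^{(\alpha,\alpha)}$ denotes the orthonormal ultraspherical (Jacobi) polynomial of degree $k$, i.e. the sequence $(\mathbf{P}_k^{(\alpha,\alpha)})_{k\ge0}$ is orthonormal on $[-1,1]$ with respect to the weight $(1-x^2)^{\alpha}$. Define $$\mathcal{M}_k^{\alpha}=\max_{x\in[-1,1]}\sqrt{1-x^2}\,(1-x^2)^{\alpha}\left(\mathbf{P}_k^{(\alpha,\alpha)}(x)\right)^2=\max_{x\in[-1,1]}(1-x^2)^{\alpha+\frac12}\left(\mathbf{P}_k^{(\alpha,\alpha)}(x)\right)^2 .$$ *)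

(* Defs.v *)
From HB Require Import structures.
From mathcomp Require Import all_boot all_order all_algebra.
From mathcomp Require Import all_classical all_reals all_analysis.
From mathcomp Require Import lra.
Set Implicit Arguments.
Unset Strict Implicit.
Unset Printing Implicit Defensive.
Import Order.TTheory GRing.Theory Num.Theory.
Import numFieldNormedType.Exports.
Local Open Scope classical_set_scope.
Local Open Scope ring_scope.

Definition ultraspherical_weight (R : realType) (alpha x : R) : R :=
  (1 - x ^+ 2) `^ alpha.

(* Determines each [P k] up to sign; [M_ultraspherical] only involves its
   square. The integral is extended-real valued, so that no default value of an
   undefined or infinite integral can satisfy the condition. *)
Definition orthonormal_ultraspherical (R : realType) (alpha : R)
    (P : nat -> {poly R}) : Prop :=
  (forall k : nat, size (P k) = k.+1) /\
  (forall j k : nat,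
    (\int[@lebesgue_measure R]_(x in `[(-1)%R, 1%R])
       (ultraspherical_weight alpha x * (P j).[x] * (P k).[x])%:E)%E
    = ((j == k)%:R)%:E).

(* The maximum over [-1, 1] is taken as a supremum, which is attained when
   [- (1 / 2) < alpha] by [M_ultraspherical_max]. *)
Definition M_ultraspherical (R : realType) (alpha : R) (p : {poly R}) : R :=
  sup [set Num.sqrt (1 - x ^+ 2) * ultraspherical_weight alpha x * p.[x] ^+ 2
      | x in `[(-1)%R, 1%R]].

Lemma continuous_max0_powR (R : realType) (r : R) : 0 < r ->
  continuous (fun y : R => (Num.max y 0) `^ r).
Proof.
move=> r0 y; have [y0|y0|->] := ltgtP y 0.
- apply: (@near_cst_continuous _ _ 0); near=> z; rewrite max_r ?powR0 ?gt_eqF//.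
  by apply: ltW; near: z; exact: lt_nbhsl.
- have : z `^ r @[z --> y] --> y `^ r.
    have [dr _] := @is_derive1_powR R r y y0.
    have /derivable1_diffP/differentiable_continuous := dr.
    exact.
  rewrite /continuous_at max_l ?(ltW y0)//; apply: cvg_trans.
  apply: near_eq_cvg; near=> z; rewrite max_l//.
  by apply: ltW; near: z; exact: lt_nbhsr.
- rewrite /continuous_at maxxx powR0 ?gt_eqF//; apply/cvgr0Pnorm_lt => e e0.
  have d0 : 0 < e `^ r^-1 by exact: powR_gt0.
  near=> z; rewrite ger0_norm ?powR_ge0//.
  have -> : e = (e `^ r^-1) `^ r by rewrite -powRrM mulVf ?gt_eqF// powRr1// ltW.
  apply: gt0_ltr_powR => //; rewrite ?nnegrE ?le_max ?lexx ?orbT ?ltW//.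
  rewrite gt_max d0 andbT.
  by near: z; exact: lt_nbhsl.
Unshelve. all: by end_near. Qed.

Lemma M_ultraspherical_max (R : realType) (alpha : R) (p : {poly R}) :
  - (1 / 2) < alpha ->
  let f x :=
    Num.sqrt (1 - x ^+ 2) * ultraspherical_weight alpha x * p.[x] ^+ 2 in
  exists2 x, x \in `[(-1)%R, 1%R] &
    M_ultraspherical alpha p = f x /\
    forall y, y \in `[(-1)%R, 1%R] -> f y <= f x.
Proof.
move=> ha f; have r0 : 0 < alpha + 2^-1 by move: ha; rewrite div1r; lra.
have fE x : x \in `[(-1)%R, 1%R] ->
    f x = (Num.max (1 - x ^+ 2) 0) `^ (alpha + 2^-1) * p.[x] ^+ 2.
  rewrite in_itv/= => /andP[x1 x2].
  have y0 : 0 <= 1 - x ^+ 2 by nra.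
  rewrite /f /ultraspherical_weight max_l// -powR12_sqrt//.
  move: y0; rewrite le_eqVlt => /predU1P[<-|y0].
    by rewrite (@powR0 _ 2^-1) ?(@powR0 _ (alpha + 2^-1)) ?gt_eqF// !mul0r.
  by rewrite -powRD ?(addrC 2^-1)// (gt_eqF y0) implybT.
have fc : {within `[(-1)%R, 1%R], continuous f}.
  pose g x := (Num.max (1 - x ^+ 2) 0) `^ (alpha + 2^-1) * p.[x] ^+ 2.
  apply: (@subspace_eq_continuous _ _ _ g).
    by move=> x /set_mem xI; exact/esym/fE.
  apply: continuous_subspaceT => x; apply: cvgM.
    apply: (@continuous_comp _ _ _ (fun x : R => 1 - x ^+ 2)
      (fun y : R => (Num.max y 0) `^ (alpha + 2^-1))).
      by apply: cvgB; [exact: cvg_cst|exact: exprn_continuous].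
    exact: continuous_max0_powR.
  apply: (@continuous_comp _ _ _ (horner p) (fun y : R => y ^+ 2)).
    exact: continuous_horner.
  exact: exprn_continuous.
have [|c cI cmax] := EVT_max _ fc; first by lra.
exists c => //; split => //.
apply/eqP; rewrite eq_le; apply/andP; split.
  apply: ge_sup; first by exists (f c), c.
  by move=> _ [x xI <-]; exact: cmax.
apply: ub_le_sup; last by exists c.
by exists (f c) => _ [x xI <-]; exact: cmax.
Qed.

Definition mu_parity (R : realType) (k : nat) : R :=
  if odd k then 22 else 10 / 7.

(* Main.v *)
(* Write x = cos t and v(t) = (sin t)^(alpha + 1/2) P_k(cos t); the function to
   maximise is v^2, which satisfies v'' + b v = 0 with
   b(t) = L - a / sin(t)^2, L = (k + alpha + 1/2)^2, a = alpha^2 - 1/4, while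
   orthonormality says that v^2 has integral 1 over [0, pi].
   1. The energy v'^2 + b v^2 increases on [0, pi/2] from 0. Comparing v^2 with
      a parabola on the left of its outermost maximum gives
      b^(3/2) >= (2/3) b' there. So at any t1 with b(t1)^(3/2) < (2/3) b'(t1),
      v^2 is still increasing, and Sonin's function S = v^2 + v'^2 / b, which
      decreases on [t1, pi/2], bounds v^2 everywhere by S(t1).
   2. For f = sqrt((1 - x^2) / (A - x^2)) with A slightly larger than the square
      of the turning point, T = f v'^2 - f' v v' + (f b + f''/2) v^2 increases
      on [t1, pi/2], because T' = (f'''/2 + 2 b f' + b' f) v^2. Integrating f T,
      which is (f^2 v v' - (3/2) f f' v^2)' plus at most 2 L v^2, bounds T(t1),
      hence S(t1), by the integral of v^2.
   3. The resulting bound is compared with alpha^(1/3) (1 + alpha/k)^(1/6) by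
      cutting the range of alpha into finitely many intervals.
   Parity only enters through v v' = 0 at pi/2 and the evenness of v^2. *)
Require Import Defs.
From mathcomp Require Import all_boot all_order all_algebra.
From mathcomp Require Import all_classical all_reals all_analysis.
From mathcomp Require Import ring lra.
Set Implicit Arguments.
Unset Strict Implicit.
Unset Printing Implicit Defensive.
Import Order.TTheory GRing.Theory Num.Theory.
Import numFieldNormedType.Exports.
Local Open Scope classical_set_scope.
Local Open Scope ring_scope.

(** * Calculus *)

Section Calculus.
Variable R : realType.
Implicit Types (f g : R -> R) (x a b c : R).

Lemma is_derive1D f g x a b : is_derive x 1 f a -> is_derive x 1 g b ->
  is_derive x 1 (fun t => f t + g t) (a + b).
Proof. exact: is_deriveD. Qed.

Lemma is_derive1N f x a : is_derive x 1 f a ->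
  is_derive x 1 (fun t => - f t) (- a).
Proof. exact: is_deriveN. Qed.

Lemma is_derive1M f g x a b : is_derive x 1 f a -> is_derive x 1 g b ->
  is_derive x 1 (fun t => f t * g t) (f x * b + g x * a).
Proof. exact: is_deriveM. Qed.

Lemma is_derive1X f n x a : is_derive x 1 f a ->
  is_derive x 1 (fun t => f t ^+ n) (n%:R * f x ^+ n.-1 * a).
Proof.
move=> df; have -> : (fun t => f t ^+ n) = f ^+ n.
  by apply/funext => t; rewrite exprfctE.
by apply: is_derive_eq.
Qed.

Lemma is_derive1V f x a : f x != 0 -> is_derive x 1 f a ->
  is_derive x 1 (fun t => (f t)^-1) (- (f x) ^- 2 * a).
Proof. exact: is_deriveV. Qed.

Lemma is_derive1_const x c : is_derive x 1 (fun=> c) 0.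
Proof. exact: is_derive_cst. Qed.

Lemma is_derive1_ident x : is_derive x 1 (fun t : R => t) 1.
Proof. exact: is_derive_id. Qed.

Lemma is_derive1_chain f g x a b :
  is_derive (g x) 1 f a -> is_derive x 1 g b ->
  is_derive x 1 (fun t => f (g t)) (a * b).
Proof. exact: is_derive1_comp. Qed.

Lemma is_derive1_sqrtr f x a : 0 < f x -> is_derive x 1 f a ->
  is_derive x 1 (fun t => Num.sqrt (f t)) ((2 * Num.sqrt (f x))^-1 * a).
Proof. by move=> fx; apply: is_derive1_chain; exact: is_derive1_sqrt. Qed.

Lemma is_derive1_horner (p : {poly R}) f x a : is_derive x 1 f a ->
  is_derive x 1 (fun t => p.[f t]) (p^`().[f x] * a).
Proof. by apply: is_derive1_chain; exact: is_derive_poly. Qed.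

Lemma is_derive1_continuous f x a : is_derive x 1 f a -> {for x, continuous f}.
Proof. by case=> /derivable1_diffP/differentiable_continuous. Qed.

(** Differentiability is asked only inside the interval: at the singular endpoint 0 the functions
    studied below are merely known to be continuous. *)
Lemma derive_nondecreasing f (df : R -> R) a b : a <= b ->
  {within `[a, b], continuous f} ->
  (forall x, a < x < b -> is_derive x 1 f (df x)) ->
  (forall x, a < x < b -> 0 <= df x) ->
  f a <= f b.
Proof.
move=> ab fc fd dge0.
move: ab; rewrite le_eqVlt => /predU1P[->//|ab].
have [c cab E] : exists2 c, c \in `]a, b[ & f b - f a = df c * (b - a).
  apply: MVT => // x; rewrite in_itv/= => xab; exact: fd.
rewrite -subr_ge0 E mulr_ge0//; last by rewrite subr_ge0 ltW.
by apply: dge0; move: cab; rewrite in_itv.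
Qed.

Lemma derive_nondecreasing_cc f (df : R -> R) a b : a <= b ->
  (forall x, a <= x <= b -> is_derive x 1 f (df x)) ->
  (forall x, a <= x <= b -> 0 <= df x) ->
  f a <= f b.
Proof.
move=> ab fd dge0; apply: (@derive_nondecreasing f df) => //.
- apply: derivable_within_continuous => x; rewrite in_itv/= => xab.
  by have [] := fd x xab.
- by move=> x /andP[ax xb]; apply: fd; rewrite !ltW.
- by move=> x /andP[ax xb]; apply: dge0; rewrite !ltW.
Qed.

End Calculus.

(** Syntax-directed differentiation. The value of the derivative is left to unification and is
    compared afterwards with the intended one through [is_derive_eq]; conditions of positivity or
    nonvanishing remain as subgoals. *)
Ltac der1 :=
  lazymatch goal with
  | |- is_derive _ _ (fun=> ?c) _ => eapply is_derive1_const
  | |- is_derive _ _ (fun t => @?f t + @?g t) _ => eapply (@is_derive1D _ f g)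
  | |- is_derive _ _ (fun t => - @?f t) _ => eapply (@is_derive1N _ f)
  | |- is_derive _ _ (fun t => @?f t * @?g t) _ => eapply (@is_derive1M _ f g)
  | |- is_derive _ _ (fun t => @?f t ^+ ?n) _ => eapply (@is_derive1X _ f n)
  | |- is_derive _ _ (fun t => (@?f t)^-1) _ => eapply (@is_derive1V _ f)
  | |- is_derive _ _ (fun t => Num.sqrt (@?f t)) _ =>
      eapply (@is_derive1_sqrtr _ f)
  | |- is_derive _ _ (fun t => horner ?p (@?f t)) _ =>
      eapply (@is_derive1_horner _ p f)
  | |- is_derive _ _ (fun t => t) _ => eapply is_derive1_ident
  | |- is_derive _ _ (fun t => sin t) _ => eapply is_derive_sin
  | |- is_derive _ _ (fun t => cos t) _ => eapply is_derive_cos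
  end.

Ltac der := repeat first [eassumption | der1].

(** * The ultraspherical differential equation *)

Section Weight.
Variable R : realType.
Variable alpha : R.
Hypothesis alpha_gt0 : 0 < alpha.
Notation mu := (@lebesgue_measure R).
Notation I := [set` `[(- 1 : R), (1 : R)]].
Implicit Types (p q r : {poly R}).

Let wt := @ultraspherical_weight R alpha.

(** Truncating the base at 0 extends the weight continuously to the whole line, whereas [powR] takes
    a default value at negative bases. *)
Lemma continuous_max0_powR_horner (s : R) r : 0 < s ->
  continuous (fun x : R => (Num.max (1 - x ^+ 2) 0) `^ s * r.[x]).
Proof.
move=> s0 x; apply: cvgM; last exact: continuous_horner.
apply: (@continuous_comp _ _ _ (fun x : R => 1 - x ^+ 2)
  (fun y : R => (Num.max y 0) `^ s)); last exact: continuous_max0_powR.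
by apply: cvgB; [exact: cvg_cst|exact: exprn_continuous].
Qed.

Lemma weight_max0 (s x : R) : -1 <= x <= 1 ->
  ultraspherical_weight s x = (Num.max (1 - x ^+ 2) 0) `^ s.
Proof. by move=> hx; rewrite /ultraspherical_weight max_l//; nra. Qed.

Lemma weight_continuous r :
  {within I, continuous (fun x => wt x * r.[x])}.
Proof.
apply: (@subspace_eq_continuous _ _ _
  (fun x : R => (Num.max (1 - x ^+ 2) 0) `^ alpha * r.[x])).
  by move=> x /set_mem/=; rewrite in_itv/= => hx;
    rewrite -(weight_max0 alpha hx).
exact/continuous_subspaceT/continuous_max0_powR_horner.
Qed.

Lemma weight_integrable r : mu.-integrable I (EFin \o (fun x => wt x * r.[x])).
Proof.
apply: continuous_compact_integrable; first exact: segment_compact.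
exact: weight_continuous.
Qed.

Definition weight_int r : R := (\int[mu]_(x in I) (wt x * r.[x]))%R.

Lemma weight_intE r :
  (\int[mu]_(x in I) (wt x * r.[x])%:E)%E = (weight_int r)%:E.
Proof.
by rewrite /weight_int /Rintegral fineK//; apply: integrable_fin_num => //;
  exact: weight_integrable.
Qed.

Lemma weight_intD p q : weight_int (p + q) = weight_int p + weight_int q.
Proof.
rewrite /weight_int -RintegralD//; try exact: weight_integrable.
by apply: eq_Rintegral => x _; rewrite hornerD mulrDr.
Qed.

Lemma weight_intZ (c : R) p : weight_int (c *: p) = c * weight_int p.
Proof.
rewrite /weight_int -RintegralZl//; last exact: weight_integrable.
by apply: eq_Rintegral => x _; rewrite hornerZ mulrCA.
Qed.

(** The Gegenbauer operator. With [w] the weight, [w] times the image of [p] is the derivative of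
    [(1 - x^2)^(alpha + 1) p'], which is its Sturm-Liouville form. *)
Definition ultraspherical_op p : {poly R} :=
  (1 - 'X^2) * p^`()^`() - (2 * (alpha + 1)) *: ('X * p^`()).

(** The difference of the two integrands is the derivative of [F], that is of
    [(1 - x^2)^(alpha + 1) (p' q - p q')], which vanishes at both endpoints. *)
Lemma ultraspherical_op_symmetric p q :
  weight_int (ultraspherical_op p * q) = weight_int (p * ultraspherical_op q).
Proof.
apply/eqP; rewrite -subr_eq0 -mulN1r -weight_intZ -weight_intD; apply/eqP.
set r := _ + _.
have r_E x : r.[x] = (1 - x ^+ 2) *
  (p^`()^`().[x] * q.[x] - p.[x] * q^`()^`().[x])
    - 2 * (alpha + 1) * x * (p^`().[x] * q.[x] - p.[x] * q^`().[x]).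
  by rewrite /r /ultraspherical_op !hornerE /=; ring.
pose s := p^`() * q - p * q^`().
pose F (x : R) := (Num.max (1 - x ^+ 2) 0) `^ (alpha + 1) * s.[x].
have a1 : 0 < alpha + 1 by rewrite addr_gt0.
have Fc : continuous F by exact: continuous_max0_powR_horner.
have dF (x : R) : -1 < x < 1 -> is_derive x 1 F (wt x * r.[x]).
  move=> hx; have y0 : 0 < 1 - x ^+ 2 by nra.
  have Gd : is_derive x 1 (fun x => (1 - x ^+ 2) `^ (alpha + 1) * s.[x])
    (wt x * r.[x]).
    have Hd : is_derive x 1 (fun x => (1 - x ^+ 2) `^ (alpha + 1))
        ((alpha + 1) * wt x * (- (2 * x))).
      have D : is_derive x 1 (fun x => 1 - x ^+ 2) (- (2 * x)).
        by eapply is_derive_eq; [der|rewrite /=; ring].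
      have P : is_derive (1 - x ^+ 2) 1 (fun y => y `^ (alpha + 1))
          ((alpha + 1) * (1 - x ^+ 2) `^ (alpha + 1 - 1))
            by exact: is_derive1_powR.
      rewrite addrK in P.
      exact: (@is_derive1_chain _ (fun y => y `^ (alpha + 1))
        (fun x => 1 - x ^+ 2) x _ _ P D).
    eapply is_derive_eq; first by der.
    rewrite /= powRD; last by rewrite gt_eqF// implybT.
    rewrite powRr1 ?(ltW y0)// /wt /ultraspherical_weight r_E /s.
    by rewrite !(derivB, derivM) !hornerE/=; ring.
  apply: near_eq_is_derive Gd.
  near=> z; rewrite /F max_l//.
  have : -1 < z < 1.
    apply/andP; split; near: z; [apply: lt_nbhsr|apply: lt_nbhsl];
      by case/andP: hx.
  by nra.
have : (\int[mu]_(x in I) (wt x * r.[x])%:E = (F 1)%:E - (F (-1))%:E)%E.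
  apply: continuous_FTC2; first by lra.
  - exact: weight_continuous.
  - split.
    + by move=> x; rewrite in_itv/= => /dF[].
    + exact/cvg_at_right_filter/Fc.
    + exact/cvg_at_left_filter/Fc.
  - by move=> x; rewrite in_itv/= => /dF[_]; rewrite derive1E.
rewrite weight_intE /F sqrrN expr1n subrr maxxx powR0 ?gt_eqF// !mul0r sube0.
by case.
Unshelve. all: by end_near. Qed.

(** Only the indices [i] and [i.+2] interact: the diagonal term yields the eigenvalues, and the step
    of 2 yields parity. *)
Lemma coef_ultraspherical_op p i : (ultraspherical_op p)`_i =
  p`_i.+2 * (i.+2 * i.+1)%:R - i%:R * (i%:R + 2 * alpha + 1) * p`_i.
Proof.
rewrite /ultraspherical_op mulrBl mul1r coefB coefB coefZ coefXnM coefXM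
  !coef_deriv.
case: i => [|[|i]] /=.
- by ring.
- by ring.
- by rewrite subn2/=; ring.
Qed.

Let eigenvalue (k : nat) : R := k%:R * (k%:R + 2 * alpha + 1).

Lemma eigenvalue_lt j k : (j < k)%N -> eigenvalue j < eigenvalue k.
Proof.
move=> jk; have jkR : j%:R + 1 <= k%:R :> R by rewrite natr1 ler_nat.
have j0 : 0 <= j%:R :> R by [].
have -> : eigenvalue k = eigenvalue j + (k%:R - j%:R) *
  (k%:R + j%:R + 2 * alpha + 1).
  by rewrite /eigenvalue; ring.
by rewrite ltrDl mulr_gt0//; move: jkR j0 alpha_gt0; lra.
Qed.

Lemma size_ultraspherical_op p : (size (ultraspherical_op p) <= size p)%N.
Proof.
apply/leq_sizeP => i hi; rewrite coef_ultraspherical_op.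
by rewrite (nth_default _ hi) nth_default ?mulr0 ?mul0r ?subr0//
  (leq_trans hi)// -addn2 leq_addr.
Qed.

Variable P : nat -> {poly R}.
Hypothesis hP : orthonormal_ultraspherical alpha P.

Let sizeP k : size (P k) = k.+1. Proof. by case: hP. Qed.

Let orthoP j k : weight_int (P j * P k) = (j == k)%:R.
Proof.
have [_ /(_ j k)] := hP => h; apply/EFin_inj; rewrite -weight_intE -h.
by apply: eq_integral => x _; rewrite hornerM mulrA.
Qed.

Let peel n r : (size r <= n.+1)%N ->
  exists (c : R) s, r = c *: P n + s /\ (size s <= n)%N.
Proof.
move=> rn; have lc : (P n)`_n != 0.
  have := lead_coef_eq0 (P n); rewrite lead_coefE sizeP/= => ->.
  by rewrite -size_poly_eq0 sizeP.
exists (r`_n / (P n)`_n), (r - (r`_n / (P n)`_n) *: P n).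
split; first by rewrite addrC subrK.
apply/leq_sizeP => i; rewrite leq_eqVlt => /predU1P[<-|ni].
  by rewrite coefB coefZ divfK// subrr.
by rewrite coefB coefZ [r`_i]nth_default ?(leq_trans rn)// [(P n)`_i]nth_default
  ?sizeP// mulr0 subrr.
Qed.

Let ortho_lower k n r : (n <= k)%N -> (size r <= n)%N -> weight_int (P k * r) =
  0.
Proof.
elim: n r => [|n IH] r nk.
  rewrite leqn0 size_poly_eq0 => /eqP ->.
  by rewrite mulr0 -(scale0r 0) weight_intZ mul0r.
move=> /peel[c [s [-> sn]]]; rewrite mulrDr weight_intD -scalerAr weight_intZ.
by rewrite orthoP (gtn_eqF nk) mulr0 add0r IH// ltnW.
Qed.

Let ortho_zero n r : (size r <= n)%N ->
  (forall j, (j < n)%N -> weight_int (r * P j) = 0) -> r = 0.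
Proof.
elim: n r => [|n IH] r; first by rewrite leqn0 size_poly_eq0 => /eqP.
move=> /peel[c [s [-> sn]]] h.
have := h n (ltnSn n); rewrite mulrDl weight_intD -scalerAl weight_intZ orthoP
  eqxx mulr1.
rewrite [s * _]mulrC (ortho_lower (leqnn n) sn) addr0 => c0.
rewrite c0 scale0r add0r; apply: IH => // j jn.
by have := h j (ltnW jn); rewrite c0 scale0r add0r.
Qed.

(** The top coefficient of [D] cancels, so [D] has degree below [k]. By symmetry of the operator,
    which does not raise degrees, [D] is orthogonal to every [P j] with [j < k]; these span the
    polynomials of degree below [k], so [D] is zero. *)
Lemma ultraspherical_ode k : ultraspherical_op (P k) + eigenvalue k *: P k = 0.
Proof.
set D := _ + _.
have Dk : (size D <= k)%N.
  apply/leq_sizeP => i; rewrite coefD coefZ coef_ultraspherical_op.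
  rewrite leq_eqVlt => /predU1P[<-|ki].
    by rewrite [_`_k.+2]nth_default ?sizeP// mul0r /eigenvalue sub0r addNr.
  rewrite [(P k)`_i]nth_default ?sizeP// nth_default.
    by rewrite !mulr0 mul0r subrr addr0.
  by rewrite sizeP (leq_trans ki)// ltnW.
apply: (ortho_zero Dk) => j jk.
rewrite /D mulrDl weight_intD ultraspherical_op_symmetric -scalerAl weight_intZ.
rewrite orthoP (gtn_eqF jk) mulr0 addr0.
apply: (ortho_lower (leqnn k)).
by rewrite (leq_trans (size_ultraspherical_op _))// sizeP.
Qed.

Lemma ultraspherical_ode_horner k (x : R) :
  (1 - x ^+ 2) * (P k)^`()^`().[x] =
  2 * (alpha + 1) * x * (P k)^`().[x] - eigenvalue k * (P k).[x].
Proof.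
have := congr1 (horner^~ x) (ultraspherical_ode k).
rewrite /ultraspherical_op !hornerE /= => h.
by apply/eqP; rewrite -subr_eq0 -[X in _ == X]h; apply/eqP; ring.
Qed.

(** Downward induction on [i], starting above the degree: the coefficient of index [i] in the
    differential equation expresses [(eigenvalue k - eigenvalue i) * (P k)_i] through [(P k)_(i+2)],
    and the eigenvalues are distinct. *)
Lemma ultraspherical_coef_parity k i : odd (k + i) -> (P k)`_i = 0.
Proof.
move: {2}(k - i)%N (leqnn (k - i)) => n; elim: n i => [|n IH] i kin oki.
  have ki : (k < i)%N.
    rewrite ltn_neqAle -subn_eq0 -leqn0 kin andbT; apply/eqP => ki.
    by rewrite ki addnn odd_double in oki.
  by rewrite nth_default// sizeP.
have [ki|ik] := ltnP k i; first by rewrite nth_default// sizeP.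
have {}ik : (i < k)%N.
  rewrite ltn_neqAle ik andbT; apply/eqP => ki.
  by rewrite ki addnn odd_double in oki.
have p2 : (P k)`_i.+2 = 0.
  apply: IH; last by rewrite !addnS/= negbK.
  by move: kin; rewrite !leq_subLR => /leq_trans; apply;
    rewrite addnS !addSn leqnSn.
have := congr1 (fun q : {poly R} => q`_i) (ultraspherical_ode k).
rewrite coefD coefZ coef_ultraspherical_op p2 mul0r coef0 => /eqP.
rewrite sub0r -mulNr -mulrDl mulf_eq0 addrC subr_eq0 => /orP[/eqP h|/eqP//].
by have := eigenvalue_lt ik; rewrite h ltxx.
Qed.

Lemma ultraspherical_parity k (x : R) : (P k).[- x] = (-1) ^+ k * (P k).[x].
Proof.
rewrite !horner_coef mulr_sumr; apply: eq_bigr => i _.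
have [oki|oki] := boolP (odd (k + i)).
  by rewrite ultraspherical_coef_parity// !mul0r mulr0.
rewrite [(- x) ^+ i]exprNn mulrCA; congr (_ * _).
rewrite -signr_odd -[in RHS]signr_odd.
by move: oki; rewrite oddD negb_add => /eqP ->.
Qed.

(** Parity kills the coefficient of index 0 for odd [k] and that of index 1 for even [k]. This
    provides [v * u = 0] at [pi / 2]. *)
Lemma ultraspherical_critical0 k : (P k).[0] * (P k)^`().[0] = 0.
Proof.
rewrite !horner_coef0 coef_deriv mulr1n.
have [ok|ok] := boolP (odd k).
  by rewrite [_`_0]ultraspherical_coef_parity ?mul0r// addn0.
by rewrite [_`_1]ultraspherical_coef_parity ?mulr0// addn1/=.
Qed.

End Weight.

(** * Energy and Sonin's function *)

Section SturmLiouville.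
Variable R : realType.
Variables (a L : R) (v u : R -> R).
Hypothesis a_gt0 : 0 < a.
Let b (t : R) : R := L - a / sin t ^+ 2.
(** At 0 the division in [b] takes its default value, so [E0] and [E_cont] together express that the
    energy tends to 0 at the singular endpoint. *)
Let E t := u t ^+ 2 + b t * v t ^+ 2.
Hypothesis dv : forall t : R, 0 < t <= pi / 2 -> is_derive t 1 v (u t).
Hypothesis du : forall t : R, 0 < t <= pi / 2 -> is_derive t 1 u (- b t * v t).
Hypothesis v0 : v 0 = 0.
Hypothesis E0 : E 0 = 0.
Hypothesis v_cont : {within `[0, pi / 2], continuous v}.
Hypothesis E_cont : {within `[0, pi / 2], continuous E}.

Let sin_gt0 (t : R) : 0 < t <= pi / 2 -> 0 < sin t.
Proof.
move=> /andP[t0 t1]; apply: sin_gt0_pi; rewrite t0/=.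
by have := pi_gt0 R; lra.
Qed.

Let cos_ge0 (t : R) : 0 <= t <= pi / 2 -> 0 <= cos t.
Proof.
move=> /andP[t0 t1]; apply: cos_ge0_pihalf; rewrite t1 andbT.
by have := pi_gt0 R; lra.
Qed.

Let db (t : R) : 0 < t <= pi / 2 -> is_derive t 1 b
  (2 * a * cos t / sin t ^+ 3).
Proof.
move=> ht; have s0 := sin_gt0 ht.
have sn : sin t != 0 by rewrite gt_eqF.
rewrite /b; eapply is_derive_eq; first by der; rewrite /= expf_neq0.
by rewrite /=; field.
Qed.

Let dE (t : R) : 0 < t <= pi / 2 ->
  is_derive t 1 E (2 * a * cos t / sin t ^+ 3 * v t ^+ 2).
Proof.
move=> ht; have := db ht; have := dv ht; have := du ht => ? ? ?.
by rewrite /E; eapply is_derive_eq; [der|rewrite /=; ring].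
Qed.

Lemma energy_nondecreasing s (t : R) : 0 <= s -> s <= t -> t <= pi / 2 -> E s <=
  E t.
Proof.
move=> s0 st t1.
apply: (@derive_nondecreasing _ E
  (fun t => 2 * a * cos t / sin t ^+ 3 * v t ^+ 2)) => //.
- apply: continuous_subspaceW E_cont; apply: subset_itv; rewrite bnd_simp//.
- by move=> x /andP[sx xt]; apply: dE;
    rewrite (le_lt_trans s0 sx)/= (le_trans (ltW xt)).
- move=> x /andP[sx xt].
  have x0 : 0 < x <= pi / 2 by rewrite (le_lt_trans s0 sx)/=
    (le_trans (ltW xt)).
  have sx0 := sin_gt0 x0.
  have cx0 : 0 <= cos x by apply: cos_ge0; case/andP: x0 => /ltW -> ->.
  by rewrite mulr_ge0 ?sqr_ge0// divr_ge0 ?exprn_ge0 ?(ltW sx0)// !mulr_ge0//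
    ltW.
Qed.

Lemma energy_ge0 (t : R) : 0 <= t <= pi / 2 -> 0 <= E t.
Proof. by move=> /andP[t0 t1]; rewrite -E0; apply: energy_nondecreasing. Qed.

(* Left of the maximum [(v ^+ 2)'' >= - 2 * b t * v t ^+ 2], so [v ^+ 2] stays
   above a parabola; feeding that into [E' = b' * v ^+ 2] bounds
   [E t = b t * v t ^+ 2] from below. *)
Lemma potential_at_max (t : R) : 0 < t <= pi / 2 -> u t = 0 -> v t != 0 ->
  (forall s, 0 <= s <= t -> v s ^+ 2 <= v t ^+ 2) ->
  0 < b t /\ 4 / 3 * a * cos t / sin t ^+ 3 <= b t * Num.sqrt (b t).
Proof.
move=> ht ut vt vmax; have /andP[t0 t1] := ht.
have M0 : 0 < v t ^+ 2 by rewrite exprn_even_gt0.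
set M := v t ^+ 2 in M0 vmax *; set be := b t.
have be0 : 0 <= be.
  have : 0 <= E t by apply: energy_ge0; rewrite ltW.
  by rewrite /E ut expr0n add0r pmulr_lge0.
have bmono s : 0 < s <= t -> b s <= be.
  move=> /andP[s0 st]; apply: (@derive_nondecreasing_cc _ b
    (fun t => 2 * a * cos t / sin t ^+ 3)) st _ _.
    move=> x /andP[sx xt]; apply: db; rewrite (lt_le_trans s0 sx)/=;
      exact: le_trans t1.
  move=> x /andP[sx xt].
  have x0 : 0 < x <= pi / 2 by rewrite (lt_le_trans s0 sx)/= (le_trans xt).
  have sx0 := sin_gt0 x0.
  have cx0 : 0 <= cos x by apply: cos_ge0; case/andP: x0 => /ltW -> ->.
  by rewrite divr_ge0 ?exprn_ge0 ?(ltW sx0)// !mulr_ge0// ltW.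
have slope s : 0 < s <= t -> 2 * v s * u s <= 2 * be * M * (t - s).
  move=> /andP[s0 st].
  have : 2 * v s * u s + 2 * be * M * (s - t) <= 2 * v t * u t + 2 * be * M *
    (t - t).
    apply: (@derive_nondecreasing_cc _
      (fun s => 2 * v s * u s + 2 * be * M * (s - t))
      (fun s => 2 * u s ^+ 2 + 2 * (be * M - b s * v s ^+ 2))) => //.
      move=> x /andP[sx xt].
      have x0 : 0 < x <= pi / 2 by rewrite (lt_le_trans s0 sx)/= (le_trans xt).
      have := dv x0; have := du x0 => ? ?.
      by eapply is_derive_eq; [der|rewrite /=; ring].
    move=> x /andP[sx xt].
    have x0 := lt_le_trans s0 sx.
    apply: addr_ge0; first by rewrite mulr_ge0 ?sqr_ge0.
    rewrite mulr_ge0// subr_ge0.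
    have [bx|bx] := leP (b x) 0.
      apply: (@le_trans _ _ 0); last by rewrite mulr_ge0// ltW.
      by rewrite mulr_le0_ge0// sqr_ge0.
    apply: ler_pM => //; [exact: ltW|exact: sqr_ge0| |].
      by apply: bmono; rewrite x0.
    by apply: vmax; rewrite (ltW x0).
  by rewrite ut; lra.
have wlb s : 0 <= s <= t -> M * (1 - be * (t - s) ^+ 2) <= v s ^+ 2.
  move=> /andP[s0 st].
  have : - v s ^+ 2 + M * (1 - be * (t - s) ^+ 2)
      <= - v t ^+ 2 + M * (1 - be * (t - t) ^+ 2).
    pose F := fun s => - v s ^+ 2 + M * (1 - be * (t - s) ^+ 2).
    apply: (@derive_nondecreasing _ F
      (fun s => 2 * be * M * (t - s) - 2 * v s * u s)) => //.
    - have sub : `[s, t] `<=` `[0, pi / 2] by apply: subset_itv;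
        rewrite bnd_simp.
      have vc := continuous_subspaceW sub v_cont.
      move=> x; apply: cvgD; last first.
        apply: (@continuous_subspaceT _ _ _
          (fun s => M * (1 - be * (t - s) ^+ 2))).
        move=> z.
        apply: (@is_derive1_continuous _ _ _ (2 * be * M * (t - z))).
        by eapply is_derive_eq; [der|rewrite /=; ring].
      by apply: cvgN; apply: cvgM; exact: vc.
    - move=> x /andP[sx xt].
      have x0 : 0 < x <= pi / 2 by rewrite (le_lt_trans s0 sx)/=
        (le_trans (ltW xt)).
      have := dv x0 => ?.
      by rewrite /F; eapply is_derive_eq; [der|rewrite /=; ring].
    - move=> x /andP[sx xt]; rewrite subr_ge0; apply: slope.
      by rewrite (le_lt_trans s0 sx)/= ltW.
  by rewrite -/M; lra.
(* At [s = 0], where [v] vanishes, the parabola cannot be positive. Hence the window of length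
   [be ^ (-1/2)] on which it is nonnegative lies inside [[0, t]]. *)
have bt2 : 1 <= be * t ^+ 2.
  have /wlb : (0 : R) <= 0 <= t by rewrite lexx ltW.
  rewrite v0 expr0n/= subr0 pmulr_rle0// subr_le0//.
have be_gt0 : 0 < be.
  rewrite lt_neqAle be0 andbT; apply/negP => /eqP be_eq.
  by move: bt2; rewrite -be_eq mul0r; lra.
split => //.
set r := Num.sqrt be.
have r0 : 0 < r by rewrite sqrtr_gt0.
have rr : r ^+ 2 = be by rewrite sqr_sqrtr.
have tr : r^-1 <= t.
  rewrite -[_^-1]mul1r ler_pdivrMr// -(@ler_pXn2r _ 2) ?nnegrE ?mulr_ge0
    ?(ltW t0) ?(ltW r0)//.
  by rewrite expr1n exprMn rr mulrC.
set ga := 2 * a * cos t / sin t ^+ 3.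
have st0 := sin_gt0 ht.
have ct0 : 0 <= cos t by apply: cos_ge0; rewrite ltW.
have ga0 : 0 <= ga by rewrite divr_ge0 ?exprn_ge0 ?(ltW st0)// !mulr_ge0// ltW.
have s0 : 0 <= t - r^-1 by rewrite subr_ge0.
have srt : t - r^-1 <= t by rewrite gerBl invr_ge0 ltW.
(* On the window, [b'] is at least its value [ga] at [t] and [v ^+ 2] is above the parabola, so [E]
   grows by at least [ga] times the area under the parabola, which is [M * (2 / 3) / r]. *)
pose G s := E s + ga * M * ((t - s) - be / 3 * (t - s) ^+ 3).
have : G (t - r^-1) <= G t.
  apply: (@derive_nondecreasing _ G
    (fun s => 2 * a * cos s / sin s ^+ 3 * v s ^+ 2
     - ga * (M * (1 - be * (t - s) ^+ 2)))) => //.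
  - have sub : `[t - r^-1, t] `<=` `[0, pi / 2] by apply: subset_itv;
      rewrite bnd_simp.
    move=> x; apply: cvgD; first exact: (continuous_subspaceW sub E_cont).
    apply: (@continuous_subspaceT _ _ _
      (fun s => ga * M * ((t - s) - be / 3 * (t - s) ^+ 3))).
    move=> z; eapply is_derive1_continuous; der.
  - move=> x /andP[sx xt].
    have x0 : 0 < x <= pi / 2 by rewrite (le_lt_trans s0 sx)/=
      (le_trans (ltW xt)).
    have := dE x0 => ?.
    by rewrite /G; eapply is_derive_eq;
      [der|rewrite /=; field; rewrite gt_eqF// sin_gt0].
  - move=> x /andP[sx xt].
    have x0 : 0 < x <= pi / 2 by rewrite (le_lt_trans s0 sx)/=
      (le_trans (ltW xt)).
    have sx0 := sin_gt0 x0.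
    rewrite subr_ge0 ler_pM//.
    + rewrite mulr_ge0 ?(ltW M0)// subr_ge0 -rr -exprMn -[leRHS](expr1n _ 2).
      rewrite ler_pXn2r ?nnegrE ?mulr_ge0 ?(ltW r0) ?subr_ge0 ?(ltW xt)//.
      by rewrite mulrC -ler_pdivlMr// mul1r; lra.
    + rewrite /ga ler_pM ?invr_ge0 ?exprn_ge0 ?(ltW st0)//.
      * by rewrite !mulr_ge0// ltW.
      * rewrite ler_wpM2l ?mulr_ge0 ?(ltW a_gt0)//.
        rewrite leNgt ltr_cos ?in_itv/= -?leNgt ?(ltW xt)//.
          by have := pi_gt0 R; lra.
        by case/andP: x0 => x0 x1; have := pi_gt0 R; lra.
      * rewrite lef_pV2 ?posrE ?exprn_gt0// ler_pXn2r ?nnegrE ?(ltW st0)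
          ?(ltW sx0)//.
        rewrite leNgt ltr_sin ?in_itv/= -?leNgt ?(ltW xt)//.
          by have := pi_gt0 R; lra.
        by case/andP: x0 => x0 x1; have := pi_gt0 R; lra.
    + by apply: wlb; case/andP: x0 => x0 _; rewrite !ltW.
have Es : 0 <= E (t - r^-1).
  by apply: energy_ge0; rewrite s0/=; apply: le_trans t1.
have EtE : E t = be * M by rewrite /E ut expr0n add0r.
rewrite /G EtE subKr subrr expr0n/= mulr0 subrr mulr0 addr0.
have -> : r^-1 - be / 3 * r^-1 ^+ 3 = 2 / 3 * r^-1.
  by rewrite -rr; field; rewrite gt_eqF.
move=> H.
have {H}H : M * (ga * (2 / 3)) / r <= M * be by move: Es H; lra.
have H2 : ga * (2 / 3) <= be * r.
  by rewrite -(ler_pM2l M0) [leRHS]mulrA -ler_pdivrMr.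
apply: le_trans H2; rewrite le_eqVlt; apply/orP; left; apply/eqP.
by rewrite /ga; field; rewrite gt_eqF.
Qed.

(** * Control of [v ^+ 2] from a starting point left of its first maximum *)

Section FixedStart.
Variable t1 : R.
Hypothesis t1_int : 0 < t1 <= pi / 2.
Hypothesis bt1_gt0 : 0 < b t1.
Hypothesis bt1_small :
  b t1 * Num.sqrt (b t1) < 4 / 3 * a * cos t1 / sin t1 ^+ 3.

Let b_nondecreasing s t : 0 < s -> s <= t -> t <= pi / 2 -> b s <= b t.
Proof.
move=> s0 st t2.
apply: (@derive_nondecreasing_cc _ b (fun t => 2 * a * cos t / sin t ^+ 3)) st _
  _.
  move=> x /andP[sx xt]; apply: db; rewrite (lt_le_trans s0 sx)/=;
    exact: le_trans t2.
move=> x /andP[sx xt].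
have x0 : 0 < x <= pi / 2 by rewrite (lt_le_trans s0 sx)/= (le_trans xt).
have sx0 := sin_gt0 x0.
have cx0 : 0 <= cos x by apply: cos_ge0; case/andP: x0 => /ltW -> ->.
by rewrite divr_ge0 ?exprn_ge0 ?(ltW sx0)// !mulr_ge0// ltW.
Qed.

(** Otherwise [v ^+ 2] has its maximum over [[0, t]] at an interior point [c], where
    [potential_at_max] applies. Since [b] increases and [b'] decreases, its inequality at [c] passes
    to [t1] and contradicts [bt1_small]. *)
Lemma sqr_nondecreasing_start s t :
  0 <= s -> s <= t -> t <= t1 -> v s ^+ 2 <= v t ^+ 2.
Proof.
have /andP[t10 t12] := t1_int.
move=> s0 st tt1.
have sub : `[0, t] `<=` `[0, pi / 2].
  by apply: subset_itv; rewrite bnd_simp// (le_trans tt1).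
have wc : {within `[0, t], continuous (fun x => v x ^+ 2)}.
  have vc := continuous_subspaceW sub v_cont.
  by move=> x; apply: cvgM; exact: vc.
have [c] := EVT_max (le_trans s0 st) wc.
rewrite in_itv/= => /andP[c0 ct] cmax.
have {}cmax x : 0 <= x <= t -> v x ^+ 2 <= v c ^+ 2.
  by move=> xt; apply: cmax; rewrite in_itv.
have [vc0|vc0] := eqVneq (v c) 0.
  have vx0 x : 0 <= x <= t -> v x ^+ 2 = 0.
    move=> /cmax; rewrite vc0 expr0n/= => h; apply/eqP.
    by rewrite eq_le h sqr_ge0.
  by rewrite !vx0// ?lexx ?s0 ?(le_trans s0 st).
move: ct; rewrite le_eqVlt => /predU1P[<-|ct].
  by apply: cmax; rewrite s0.
have {}c0 : 0 < c.
  rewrite lt_neqAle c0 andbT; apply/eqP => c00.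
  by move: vc0; rewrite -c00 v0 eqxx.
have ct1 := lt_le_trans ct tt1.
have hc : 0 < c <= pi / 2 by rewrite c0 (le_trans (ltW ct1)).
have uc0 : u c = 0.
  have D1 : is_derive c 1 (fun x => v x ^+ 2) (2 * v c * u c).
    have := dv hc => ?.
    by eapply is_derive_eq; [der|rewrite /=; ring].
  have D2 : is_derive c 1 (fun x => v x ^+ 2) 0.
    apply: (@derive1_at_max _ _ 0 t) => //.
    - exact: le_trans st.
    - move=> x; rewrite in_itv/= => /andP[x0 xt].
      have hx : 0 < x <= pi / 2 by rewrite x0 (le_trans (ltW xt))//
        (le_trans tt1).
      have := dv hx => ?.
      by have [] : is_derive x 1 (fun x => v x ^+ 2) (2 * v x * u x)
        by eapply is_derive_eq; [der|rewrite /=; ring].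
    - by rewrite in_itv/= c0.
    - by move=> x; rewrite in_itv/= => /andP[x0 xt]; apply: cmax; rewrite !ltW.
  have : 2 * v c * u c = 0.
    by rewrite -(@derive_val _ _ _ _ _ _ _ D1) (@derive_val _ _ _ _ _ _ _ D2).
  by move/eqP; rewrite !mulf_eq0 (negPf vc0) pnatr_eq0/= => /eqP.
have [|bc0] := potential_at_max hc uc0 vc0.
  by move=> x /andP[x0 xc]; apply: cmax; rewrite x0 (le_trans xc)// ltW.
have bct1 : b c <= b t1 by apply: b_nondecreasing => //; rewrite ltW.
have sc0 := sin_gt0 hc.
have st0 := sin_gt0 t1_int.
have h1 : b c * Num.sqrt (b c) <= b t1 * Num.sqrt (b t1).
  by rewrite ler_pM ?sqrtr_ge0 ?(ltW bc0)// ler_wsqrtr.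
have h2 : 4 / 3 * a * cos t1 / sin t1 ^+ 3 <= 4 / 3 * a * cos c / sin c ^+ 3.
  apply: ler_pM; rewrite ?invr_ge0 ?exprn_ge0 ?(ltW st0)//.
  - by rewrite mulr_ge0 ?cos_ge0 ?t12 ?andbT ?(ltW t10)// mulr_ge0 ?(ltW a_gt0).
  - rewrite ler_wpM2l ?mulr_ge0 ?(ltW a_gt0)//.
    rewrite ltW// ltr_cos// in_itv/= ltW//=.
      by have := pi_gt0 R; lra.
    by have := pi_gt0 R; lra.
  - rewrite lef_pV2 ?posrE ?exprn_gt0// ler_pXn2r ?nnegrE ?(ltW st0)
      ?(ltW sc0)//.
    by rewrite ltW// ltr_sin// in_itv/=; have := pi_gt0 R; lra.
by move=> h3; have := lt_le_trans bt1_small (le_trans h2 (le_trans h3 h1));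
  rewrite ltxx.
Qed.

(** A negative slope of [v ^+ 2] at [t1] would persist slightly to the left of [t1], where [v ^+ 2]
    is nondecreasing. *)
Lemma slope_ge0_start : 0 <= v t1 * u t1.
Proof.
have /andP[t10 t12] := t1_int.
rewrite leNgt; apply/negP => vu0.
have Dv := dv t1_int; have Du := du t1_int.
have gc : {for t1, continuous (fun x => v x * u x)}.
  by eapply is_derive1_continuous; der.
have : \forall x \near t1, v x * u x < 0.
  have gc1 : v x * u x @[x --> t1] --> v t1 * u t1 := gc.
  exact: (cvgr_lt _ gc1 _ vu0).

move=> /nbhs_ballP[d /= d0 vud].
pose m := Num.min (d / 2) (t1 / 2).
have m0 : 0 < m by rewrite /m lt_min !divr_gt0.
have md : m <= d / 2 by rewrite /m ge_min lexx.
have mt : m <= t1 / 2 by rewrite /m ge_min lexx orbT.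
have : v t1 ^+ 2 < v (t1 - m) ^+ 2.
  have [|x| |c] := @MVT _ (fun x => v x ^+ 2) (fun x => 2 * (v x * u x))
    (t1 - m) t1.
  - by rewrite gtrBl.
  - rewrite in_itv/= => /andP[x0 xt].
    have hx : 0 < x <= pi / 2 by apply/andP; lra.
    have := dv hx => ?.
    by eapply is_derive_eq; [der|rewrite /=; ring].
  - apply: derivable_within_continuous => x; rewrite in_itv/= => /andP[x0 xt].
    have hx : 0 < x <= pi / 2 by apply/andP; lra.
    have := dv hx => ?.
    by have [] : is_derive x 1 (fun x => v x ^+ 2) (2 * v x * u x)
      by eapply is_derive_eq; [der|rewrite /=; ring].
  rewrite in_itv/= subKr => /andP[c0 ct] E1.
  have : v c * u c < 0.
    by apply: vud; rewrite /ball/= ltr_norml; lra.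
  move=> vuc; have : 2 * (v c * u c) * m < 0 by rewrite nmulr_rlt0// pmulr_rlt0.
  by lra.
by rewrite ltNge sqr_nondecreasing_start//; lra.
Qed.

Let S t := v t ^+ 2 + u t ^+ 2 / b t.

(* [S' = - b' * (u / b) ^+ 2]. *)
Lemma sqr_le_sonin t : 0 <= t <= pi / 2 -> v t ^+ 2 <= S t1.
Proof.
have /andP[t10 t12] := t1_int.
move=> /andP[t0 t2].
have bpos x : t1 <= x <= pi / 2 -> 0 < b x.
  by move=> /andP[xt x2]; apply: lt_le_trans bt1_gt0 _; exact: b_nondecreasing.
have wS x : 0 < b x -> v x ^+ 2 <= S x.
  by move=> bx; rewrite lerDl mulr_ge0 ?sqr_ge0// invr_ge0 ltW.
have [tt1|t1t] := leP t t1.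
  by apply: le_trans (wS _ bt1_gt0); exact: sqr_nondecreasing_start.
apply: le_trans (wS _ _) _; first by apply: bpos; rewrite ltW.
rewrite -lerN2.
apply: (@derive_nondecreasing_cc _ (fun t => - S t)
  (fun t => 2 * a * cos t / sin t ^+ 3 * (u t / b t) ^+ 2)) (ltW t1t) _ _.
  move=> x /andP[t1x xt].
  have hx : 0 < x <= pi / 2 by rewrite (lt_le_trans t10 t1x)/= (le_trans xt).
  have bx : b x != 0 by rewrite gt_eqF// bpos// t1x (le_trans xt).
  have := dv hx; have := du hx; have := db hx => ? ? ?.
  rewrite /S; eapply is_derive_eq; first by der.
  by rewrite /=; field; rewrite bx gt_eqF// sin_gt0.
move=> x /andP[t1x xt].
have hx : 0 < x <= pi / 2 by rewrite (lt_le_trans t10 t1x)/= (le_trans xt).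
have sx0 := sin_gt0 hx.
have cx0 : 0 <= cos x by apply: cos_ge0; case/andP: hx => /ltW -> ->.
by rewrite mulr_ge0 ?sqr_ge0// divr_ge0 ?exprn_ge0 ?(ltW sx0)// !mulr_ge0// ltW.
Qed.
End FixedStart.
End SturmLiouville.

(** * Amplitude bound *)

Section Amplitude.
Variable R : realType.
Variables (a L A t1 : R) (v u Phi : R -> R).
Let b (t : R) : R := L - a / sin t ^+ 2.
Let B : R := 1 - A.
(** The squared turning point is [1 - a / L], so [e] is [L] times the excess of [A] over it. *)
Let e : R := L * A - L + a.
(* [n t = A - cos t ^+ 2] *)
Let n (t : R) : R := sin t ^+ 2 - B.
Hypothesis A_gt0 : 0 < A.
Hypothesis A_le1 : A <= 1.
Hypothesis t1_int : 0 < t1 <= pi / 2.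
Hypothesis n1_gt0 : 0 < n t1.
Hypothesis n1_large :
  3 * A * B * n t1 + 15 / 4 * A * B ^+ 2 <= (e + B) * n t1 ^+ 2.
Hypothesis dv : forall t : R, t1 <= t <= pi / 2 -> is_derive t 1 v (u t).
Hypothesis du : forall t : R, t1 <= t <= pi / 2 -> is_derive t 1 u
  (- b t * v t).

Let B_ge0 : 0 <= B. Proof. by rewrite subr_ge0. Qed.

Let sin_gt0 (t : R) : t1 <= t <= pi / 2 -> 0 < sin t.
Proof.
case/andP: t1_int => t10 _ /andP[t1t t2]; apply: sin_gt0_pi.
by rewrite (lt_le_trans t10 t1t)/=; have := pi_gt0 R; lra.
Qed.

Let cos_ge0 (t : R) : t1 <= t <= pi / 2 -> 0 <= cos t.
Proof.
case/andP: t1_int => t10 _ /andP[t1t t2]; apply: cos_ge0_pihalf;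
  rewrite t2 andbT.
by have := pi_gt0 R; lra.
Qed.

Let n_ge (t : R) : t1 <= t <= pi / 2 -> n t1 <= n t.
Proof.
move=> ht; have /andP[t1t t2] := ht; have /andP[t10 t12] := t1_int.
rewrite lerD2r ler_pXn2r ?nnegrE ?(ltW (sin_gt0 _))// ?lexx//.
rewrite leNgt ltr_sin ?in_itv/= -?leNgt//.
  by have := pi_gt0 R; lra.
by have := pi_gt0 R; lra.
Qed.

Let n_gt0 (t : R) : t1 <= t <= pi / 2 -> 0 < n t.
Proof. by move=> ht; apply: lt_le_trans n1_gt0 (n_ge ht). Qed.

Let dn (t : R) : is_derive t 1 n (2 * sin t * cos t).
Proof. by rewrite /n; eapply is_derive_eq; [der|rewrite /=; ring]. Qed.

(* With [f = sqrt ((1 - x^2) / (A - x^2))], [x = cos t] and a prime for [d/dt]: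
   [q = f^2], [p = f f'], [g = f'^2 / 4], [N = f^2 b + f f'' / 2 - f'^2 / 4],
   [Q = f K] and [K = f u^2 - f' v u + (f b + f'' / 2) v^2]. *)
Let q (t : R) : R := sin t ^+ 2 / n t.
Let p (t : R) : R := - (sin t * cos t * B / n t ^+ 2).
Let g (t : R) : R := (1 - sin t ^+ 2) * B ^+ 2 / (4 * n t ^+ 3).
Let N (t : R) : R := L - (e + B) / n t + 3 / 4 * B * (2 * A - B) / n t ^+ 2
  + 5 / 4 * A * B ^+ 2 / n t ^+ 3.
Let Q (t : R) : R := q t * u t ^+ 2 - p t * v t * u t + (N t + g t) * v t ^+ 2.
Let K (t : R) : R := Q t * Num.sqrt (n t) / sin t.

Let dp (t : R) : t1 <= t <= pi / 2 -> is_derive t 1 p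
  (- (B * (1 - 2 * sin t ^+ 2) / n t ^+ 2
      - 4 * sin t ^+ 2 * (1 - sin t ^+ 2) * B / n t ^+ 3)).
Proof.
move=> ht; have nt := n_gt0 ht; have := dn t => ?.
have -> : - (B * (1 - 2 * sin t ^+ 2) / n t ^+ 2
      - 4 * sin t ^+ 2 * (1 - sin t ^+ 2) * B / n t ^+ 3) =
  - (B * (cos t ^+ 2 - sin t ^+ 2) / n t ^+ 2
      - 4 * sin t ^+ 2 * cos t ^+ 2 * B / n t ^+ 3).
  by rewrite !cos2sin2; congr (- (_ * _ / _ - _)); ring.
rewrite /p; eapply is_derive_eq; first by der; rewrite /= expf_neq0// gt_eqF.
by rewrite /=; field; rewrite gt_eqF.
Qed.

Let dNg (t : R) : t1 <= t <= pi / 2 -> is_derive t 1 (fun t => N t + g t)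
  (sin t * cos t * (2 * ((e + B) / n t ^+ 2
    - 3 / 2 * B * (2 * A - B) / n t ^+ 3 - 15 / 4 * A * B ^+ 2 / n t ^+ 4)
   - B ^+ 2 / (2 * n t ^+ 3) - 3 / 2 * (1 - sin t ^+ 2) * B ^+ 2 / n t ^+ 4)).
Proof.
move=> ht; have nt := n_gt0 ht; have := dn t => ?.
rewrite /N /g; eapply is_derive_eq.
  by der; rewrite /= ?mulf_neq0 ?expf_neq0// gt_eqF.
by rewrite /=; field; rewrite gt_eqF.
Qed.

Let dq (t : R) : t1 <= t <= pi / 2 -> is_derive t 1 q (2 * p t).
Proof.
move=> ht; have nt := n_gt0 ht; have := dn t => ?.
rewrite /q /p; eapply is_derive_eq.
  by der; rewrite /= gt_eqF.
have -> : B = sin t ^+ 2 - n t by rewrite subKr.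
by rewrite /=; field; rewrite gt_eqF.
Qed.

(** This is [(f''' / 2 + 2 b f' + b' f) v ^+ 2]: the terms in [u ^+ 2] and [v * u] cancel by
    [v'' = - b v]. *)
Let dK (t : R) : t1 <= t <= pi / 2 -> is_derive t 1 K
  (2 * cos t * Num.sqrt (n t) * ((e + B) / n t ^+ 2
    - 3 / 2 * B * (2 * A - B) / n t ^+ 3 - 15 / 4 * A * B ^+ 2 / n t ^+ 4)
    * v t ^+ 2).
Proof.
move=> ht; have nt := n_gt0 ht; have := dn t => ?.
have := dq ht; have := dp ht; have := dNg ht; have := dv ht; have := du ht =>
  ? ? ? ? ?.
have st := sin_gt0 ht.
have rt : 0 < Num.sqrt (n t) by rewrite sqrtr_gt0.
have : is_derive t 1 (fun t => Num.sqrt (n t))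
    (sin t * cos t * Num.sqrt (n t) / n t) => [|?].
  eapply is_derive_eq; first by der.
  by rewrite /= -{3}(sqr_sqrtr (ltW nt)); field; rewrite gt_eqF.
rewrite /K /Q; eapply is_derive_eq.
  by der; rewrite /= ?gt_eqF.
rewrite /=.
set r := Num.sqrt (n t).
rewrite /b /q /p /N /g.
have -> : e = L * A - L + a by [].
have EA : A = n t + cos t ^+ 2 by rewrite cos2sin2 /n /B; ring.
have Es : sin t ^+ 2 = n t + B by rewrite /n subrK.
have c2 : cos t ^+ 2 = 1 - sin t ^+ 2 := cos2sin2 t.
set x := n t in nt EA Es *; set s := sin t in st Es c2 *;
  set c := cos t in c2 EA *.
set V := v t; set U := u t.
have -> : B = s ^+ 2 - x by rewrite Es addrC addKr.
have -> : A = 1 - s ^+ 2 + x by rewrite EA c2 addrC.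
apply/eqP; rewrite -subr_eq0.
(* The identity holds only modulo [c ^+ 2 + s ^+ 2 = 1], so the difference of the two sides is
   exhibited as a multiple of that relation. *)
rewrite (_ : _ - _ = r * V * U * (s ^+ 2 - x) ^+ 2 / (s * x ^+ 3)
  * (c ^+ 2 - (1 - s ^+ 2))); first by rewrite c2 subrr mulr0.
by field; rewrite !gt_eqF.
Qed.

(** Divided by [x ^+ 2], the left-hand side is nonincreasing in [x], so the condition at [n t1]
    propagates to all larger values. *)
Let growth (x : R) : n t1 <= x ->
  3 * A * B * x + 15 / 4 * A * B ^+ 2 <= (e + B) * x ^+ 2.
Proof.
move=> n1x; have x0 := lt_le_trans n1_gt0 n1x.
rewrite -(ler_pM2r (exprn_gt0 2 n1_gt0)).
have h1 : (3 * A * B * n t1 + 15 / 4 * A * B ^+ 2) * x ^+ 2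
    <= (e + B) * n t1 ^+ 2 * x ^+ 2.
  by rewrite ler_wpM2r ?sqr_ge0.
have AB : 0 <= A * B by rewrite mulr_ge0// ltW.
have h2 : 0 <= A * B * n t1 * x * (x - n t1).
  by rewrite mulr_ge0 ?subr_ge0// mulr_ge0 ?(ltW x0)// mulr_ge0// ltW.
have h3 : 0 <= A * B ^+ 2 * ((x - n t1) * (x + n t1)).
  apply: mulr_ge0; first exact: mulr_ge0 (ltW A_gt0) (sqr_ge0 _).
  by apply: mulr_ge0; rewrite ?subr_ge0// addr_ge0// ltW.
move: h1 h2 h3; lra.
Qed.

Let K_nondecreasing (t : R) : t1 <= t <= pi / 2 -> K t1 <= K t.
Proof.
move=> /andP[t1t t2].
apply: (@derive_nondecreasing_cc _ K _ _ _ t1t (fun x hx => dK _)) =>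
  [x /andP[tx xt]|].
  by rewrite tx (le_trans xt).
move=> x /andP[tx xt].
have hx : t1 <= x <= pi / 2 by rewrite tx (le_trans xt).
have nx := n_gt0 hx; have nge := n_ge hx.
rewrite mulr_ge0 ?sqr_ge0// mulr_ge0//;
  first by rewrite !mulr_ge0 ?sqrtr_ge0 ?cos_ge0.
have -> : (e + B) / n x ^+ 2 - 3 / 2 * B * (2 * A - B) / n x ^+ 3
    - 15 / 4 * A * B ^+ 2 / n x ^+ 4
  = ((e + B) * n x ^+ 2 - (3 * A * B * n x + 15 / 4 * A * B ^+ 2)
     + 3 / 2 * B ^+ 2 * n x) / n x ^+ 4.
  by field; rewrite gt_eqF.
rewrite mulr_ge0 ?invr_ge0 ?exprn_ge0 ?(ltW nx)// addr_ge0 ?subr_ge0 ?growth//.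
by rewrite !mulr_ge0 ?sqr_ge0 ?(ltW nx).
Qed.

Hypothesis slope1 : 0 <= v t1 * u t1.
Hypothesis bt1_gt0 : 0 < b t1.
Hypothesis vu_mid : v (pi / 2) * u (pi / 2) = 0.
Hypothesis dPhi : forall t : R, t1 <= t <= pi / 2 ->
  is_derive t 1 Phi (- v t ^+ 2).
Hypothesis Phi_mid : Phi (pi / 2) = 0.
Hypothesis Phi1 : Phi t1 <= 1 / 2.
Hypothesis L_gt0 : 0 < L.

Let S1 : R := v t1 ^+ 2 + u t1 ^+ 2 / b t1.

Let t11 : t1 <= t1 <= pi / 2. Proof. by case/andP: t1_int => _ ->; rewrite lexx.
  Qed.

(** At [t1] the function [f] is nonincreasing and convex and [v * u >= 0], so dropping [- f' v u]
    and [f'' v ^+ 2 / 2] from [K] leaves at most [K]; what remains is [f b S1]. *)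
Let K1_ge : S1 * (b t1 * sin t1 / Num.sqrt (n t1)) <= K t1.
Proof.
have st := sin_gt0 t11; have ct := cos_ge0 t11.
have r0 : 0 < Num.sqrt (n t1) by rewrite sqrtr_gt0.
have -> : S1 * (b t1 * sin t1 / Num.sqrt (n t1)) =
    q t1 * b t1 * S1 * Num.sqrt (n t1) / sin t1.
  rewrite /q -{2}(sqr_sqrtr (ltW n1_gt0)); field.
  by rewrite !gt_eqF.
rewrite /K ler_wpM2r ?invr_ge0 ?(ltW st)// ler_wpM2r ?(ltW r0)//.
have -> : q t1 * b t1 * S1 = q t1 * u t1 ^+ 2 + q t1 * b t1 * v t1 ^+ 2.
  by rewrite /S1; field; rewrite gt_eqF.
rewrite /Q -[leRHS]addrA lerD2l.
have h1 : 0 <= - p t1 * v t1 * u t1.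
  rewrite -mulrA mulr_ge0// /p opprK mulr_ge0 ?invr_ge0 ?sqr_ge0//.
  by rewrite !mulr_ge0// ltW.
have h2 : 0 <= (N t1 + g t1 - q t1 * b t1) * v t1 ^+ 2.
  rewrite mulr_ge0 ?sqr_ge0//.
  have -> : N t1 + g t1 - q t1 * b t1 = B *
    ((1 + 2 * (1 - sin t1 ^+ 2)) / (2 * n t1 ^+ 2)
      + 3 / 2 * (1 - sin t1 ^+ 2) * B / n t1 ^+ 3).
    rewrite /N /g /q /b /e.
    have -> : A = 1 - sin t1 ^+ 2 + n t1 by rewrite /n /B; ring.
    have -> : B = sin t1 ^+ 2 - n t1 by rewrite subKr.
    by field; rewrite !gt_eqF.
  rewrite -cos2sin2 mulr_ge0// addr_ge0//.
    by apply: divr_ge0; [apply: addr_ge0|]; rewrite // mulr_ge0 ?sqr_ge0.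
  by apply: divr_ge0; [rewrite !mulr_ge0 ?sqr_ge0|rewrite exprn_ge0// ltW].
move: h1 h2; lra.
Qed.

(* The proof integrates [Z' = Q - J v^2], where [J <= 2 L] and [Q >= f K(t1)].
   The integral of [f] is [asin (x / sqrt A)], which is bounded below by
   [3 x / (2 sqrt A + sqrt (A - x^2))] to avoid inverse trigonometry. *)
Lemma amplitude_bound : S1 * (b t1 * sin t1 / Num.sqrt (n t1))
  * (3 * cos t1 / (2 * Num.sqrt A + Num.sqrt (n t1))) <= L.
Proof.
have st := sin_gt0 t11; have ct := cos_ge0 t11.
have t12 : t1 <= pi / 2 by case/andP: t1_int.
have m0 : 0 < Num.sqrt A by rewrite sqrtr_gt0.
set m := Num.sqrt A in m0 *.
have K1_ge0 : 0 <= K t1.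
  apply: le_trans K1_ge; rewrite mulr_ge0 ?divr_ge0 ?mulr_ge0 ?sqrtr_ge0
    ?(ltW bt1_gt0) ?(ltW st)//.
  by rewrite addr_ge0 ?divr_ge0 ?sqr_ge0// ltW.
pose Psi (t : R) := 3 * cos t / (2 * m + Num.sqrt (n t)).
pose Z (t : R) := q t * (v t * u t) - 3 / 2 * p t * v t ^+ 2.
(* [H' >= 0] is the sum of three facts: [h1] is [Q >= f K(t1)], [h2] is [f >= - Psi'], and [h3] is
   [J <= 2 L]. *)
pose H (t : R) := Z t + K t1 * Psi t - 2 * L * Phi t.
have : H t1 <= H (pi / 2).
  apply: (@derive_nondecreasing_cc _ H (fun t => Q t
      - (2 * L - (2 * e + 4 * B) / n t + (6 * B * (A - B) + 1 / 2 * B ^+ 2) / n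
          t ^+ 2
         + 15 / 2 * A * B ^+ 2 / n t ^+ 3) * v t ^+ 2
      - K t1 * (3 * sin t * m * (m + 2 * Num.sqrt (n t))
          / (Num.sqrt (n t) * (2 * m + Num.sqrt (n t)) ^+ 2))
      + 2 * L * v t ^+ 2)) t12 _ _.
    move=> t ht; have nt := n_gt0 ht; have := dn t => ?.
    have := dq ht; have := dp ht; have := dv ht; have := du ht;
      have := dPhi ht => ? ? ? ? ?.
    have s0 := sin_gt0 ht.
    have rt : 0 < Num.sqrt (n t) by rewrite sqrtr_gt0.
    have mr : 0 < 2 * m + Num.sqrt (n t) by rewrite addr_gt0// mulr_gt0.
    have : is_derive t 1 Psi (- (3 * sin t * m * (m + 2 * Num.sqrt (n t))
          / (Num.sqrt (n t) * (2 * m + Num.sqrt (n t)) ^+ 2))) => [|?].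
      rewrite /Psi; eapply is_derive_eq; first by der; rewrite /= ?gt_eqF.
      rewrite /=.
      have rE : Num.sqrt (n t) ^+ 2 = n t by rewrite sqr_sqrtr// ltW.
      have mE : m ^+ 2 = A by rewrite sqr_sqrtr// ltW.
      have cE : cos t ^+ 2 = m ^+ 2 - Num.sqrt (n t) ^+ 2.
        by rewrite mE rE cos2sin2 /n /B; ring.
      move: rt mr cE; set r := Num.sqrt _ => rt mr cE.
      apply/eqP; rewrite -subr_eq0.
      rewrite (_ : _ - _ = 3 * sin t / (r * (2 * m + r) ^+ 2)
         * (m ^+ 2 - r ^+ 2 - cos t ^+ 2)); first by rewrite cE subrr mulr0.
      by field; rewrite !gt_eqF.
    rewrite /H /Z; eapply is_derive_eq; first by der.
    rewrite /= /Q /N /g /q /p /b /e.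
    have -> : A = 1 - sin t ^+ 2 + n t by rewrite /n /B; ring.
    have -> : B = sin t ^+ 2 - n t by rewrite subKr.
    by field; rewrite !gt_eqF.
  move=> t ht; have nt := n_gt0 ht; have s0 := sin_gt0 ht.
  have rt : 0 < Num.sqrt (n t) by rewrite sqrtr_gt0.
  have mr : 0 < 2 * m + Num.sqrt (n t) by rewrite addr_gt0// mulr_gt0.
  have h1 : 0 <= Q t - K t1 * (sin t / Num.sqrt (n t)).
    have -> : Q t = K t * (sin t / Num.sqrt (n t)).
      by rewrite /K; field; rewrite !gt_eqF.
    by rewrite -mulrBl mulr_ge0 ?divr_ge0 ?(ltW s0) ?sqrtr_ge0// subr_ge0
      K_nondecreasing.
  have h2 : 0 <= K t1 * (sin t / Num.sqrt (n t) - 3 * sin t * m *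
    (m + 2 * Num.sqrt (n t))
          / (Num.sqrt (n t) * (2 * m + Num.sqrt (n t)) ^+ 2)).
    rewrite mulr_ge0//; move: rt mr; set r := Num.sqrt _ => rt mr.
    (* The lower bound [Psi] for the inverse sine was chosen so that the defect of its derivative is
       a perfect square. *)
    have -> : sin t / r - 3 * sin t * m * (m + 2 * r) / (r * (2 * m + r) ^+ 2)
        = sin t * (m - r) ^+ 2 / (r * (2 * m + r) ^+ 2).
      by field; rewrite !gt_eqF.
    by apply: divr_ge0; apply: mulr_ge0; rewrite ?sqr_ge0 // ltW.
  have h3 : 0 <= ((2 * e + 4 * B) / n t - (6 * B * (A - B) + 1 / 2 * B ^+ 2) / n
    t ^+ 2
         - 15 / 2 * A * B ^+ 2 / n t ^+ 3) * v t ^+ 2.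
    rewrite mulr_ge0 ?sqr_ge0//.
    have -> : (2 * e + 4 * B) / n t - (6 * B * (A - B) + 1 / 2 * B ^+ 2) / n t
      ^+ 2
         - 15 / 2 * A * B ^+ 2 / n t ^+ 3
      = (2 * ((e + B) * n t ^+ 2 - (3 * A * B * n t + 15 / 4 * A * B ^+ 2))
         + (2 * B * n t ^+ 2 + 11 / 2 * B ^+ 2 * n t)) / n t ^+ 3.
      by field; rewrite gt_eqF.
    rewrite divr_ge0 ?exprn_ge0 ?(ltW nt)// addr_ge0//.
      by rewrite mulr_ge0// subr_ge0 growth// n_ge.
    by rewrite addr_ge0// !mulr_ge0 ?sqr_ge0 ?(ltW nt).
  move: h1 h2 h3; lra.
(* [H] ends at 0, so [H t1 <= 0]. Dropping [Z t1 >= 0] and using [Phi t1 <= 1 / 2] leaves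
   [K t1 * Psi t1 <= L]. *)
have -> : H (pi / 2) = 0.
  by rewrite /H /Z /Psi /p vu_mid Phi_mid cos_pihalf
    !(mulr0, mul0r, oppr0, addr0, subr0).
have Z1 : 0 <= Z t1.
  rewrite /Z addr_ge0//; first by rewrite mulr_ge0// divr_ge0 ?sqr_ge0// ltW.
  rewrite -mulNr mulr_ge0 ?sqr_ge0// -mulrN mulr_ge0// /p opprK divr_ge0
    ?sqr_ge0//.
  by rewrite !mulr_ge0// ltW.
have P1 : 0 <= Psi t1.
  by rewrite /Psi divr_ge0 ?mulr_ge0 ?addr_ge0 ?mulr_ge0 ?sqrtr_ge0// ltW.
have LP : L * (2 * Phi t1) <= L * 1 by rewrite (ler_pM2l L_gt0); have := Phi1;
  lra.
have KP : S1 * (b t1 * sin t1 / Num.sqrt (n t1)) * Psi t1 <= K t1 * Psi t1.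
  by rewrite ler_wpM2r.
rewrite -/(Psi t1) /H => h; apply: le_trans KP _.
move: h Z1 LP; lra.
Qed.

End Amplitude.

(** * Numerical estimates *)

Lemma ler_cube (R : realType) (x y : R) : 0 <= y -> x ^+ 3 <= y ^+ 3 -> x <= y.
Proof.
move=> y0 h; have [x0|x0] := leP x 0; first exact: le_trans y0.
by rewrite -(@ler_pXn2r _ 3)// nnegrE// ltW.
Qed.

Lemma cube_root (R : realType) (x : R) : 0 < x -> exists2 z, 0 < z & z ^+ 3 = x.
Proof.
move=> x0; exists (x `^ 3^-1); first exact: powR_gt0.
by rewrite -powR_mulrn ?powR_ge0// -powRrM mulVf// powRr1 ?ltW.
Qed.

(* On each of eight intervals of values of [al]: [q] bounds
   [sqrt (19 / 10 * y / c)], [gl] bounds [al ^ (2 / 3)] from below, and [C] is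
   the coefficient that the amplitude bound leaves for [T ^+ 2]. *)
Lemma range_cover (R : realType) (al : R) : 1207 / 2000 <= al ->
  exists q C gl : R, [/\ 0 < q,
    31 / 10 * (al ^+ 2 - 1 / 4) <= q ^+ 3 * (al + 13 / 2) * (13 * al + 85 / 2),
    gl ^+ 3 <= al ^+ 2,
    [/\ 0 < gl, 1 <= C * gl, 5 / 7 * (gl ^+ 3 - 1 / 4) < (C * gl - 1) ^+ 3,
      5 / 7 * gl ^+ 2 <= C * (C * gl - 1) ^+ 2 &
      5 / 7 * gl <= C ^+ 2 * (C * gl - 1)] &
    5 / 7 <= C ^+ 3 /\ C * (19 / 10) * (2 + 9 / 19 * q ^+ 2 + q) ^+ 2
      <= 900 / 49 * (1 - 10 / 19 * q ^+ 2)].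
Proof.
move=> al_lo.
(* In each bounded range, [q] is fitted at the right end and [gl] at the left end, where their
   constraints are tightest. *)
have [al_hi|{}al_lo] := leP al (43 / 50).
  exists (157 / 1000), (2028 / 1000), (714 / 1000); split.
  - by clear; lra.
  - nra.
  - nra.
  - by clear; split; lra.
  - by clear; split; lra.
have [al_hi|{}al_lo] := leP al (32 / 25).
  exists (212 / 1000), (1892 / 1000), (904 / 1000); split.
  - by clear; lra.
  - nra.
  - nra.
  - by clear; split; lra.
  - by clear; split; lra.
have [al_hi|{}al_lo] := leP al (11 / 5).
  exists (285 / 1000), (1713 / 1000), (1178 / 1000); split.
  - by clear; lra.
  - nra.
  - nra.
  - by clear; split; lra.
  - by clear; split; lra.
have [al_hi|{}al_lo] := leP al (9 / 2).
  exists (383 / 1000), (1482 / 1000), (1691 / 1000); split.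
  - by clear; lra.
  - nra.
  - nra.
  - by clear; split; lra.
  - by clear; split; lra.
have [al_hi|{}al_lo] := leP al 10.
  exists (478 / 1000), (1271 / 1000), (2725 / 1000); split.
  - by clear; lra.
  - nra.
  - nra.
  - by clear; split; lra.
  - by clear; split; lra.
have [al_hi|{}al_lo] := leP al 24.
  exists (549 / 1000), (1122 / 1000), (4641 / 1000); split.
  - by clear; lra.
  - nra.
  - nra.
  - by clear; split; lra.
  - by clear; split; lra.
have [al_hi|{}al_lo] := leP al 80.
  exists (597 / 1000), (1026 / 1000), (8320 / 1000); split.
  - by clear; lra.
  - nra.
  - nra.
  - by clear; split; lra.
  - by clear; split; lra.
(* On the unbounded range [q ^+ 3] has to exceed [31 / 130], the limit of the required ratio as [al]
   grows. *)
exists (1241 / 2000), (980 / 1000), (18566 / 1000); split.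
- by clear; lra.
- nra.
- nra.
- by clear; split; lra.
- by clear; split; lra.
Qed.

Section Estimates.
Variable R : realType.
Variables al k : R.
Hypothesis k_ge6 : 6 <= k.
Hypothesis al_ge : 1207 / 2000 <= al.
Let a := al ^+ 2 - 1 / 4.
Let L := (k + al + 1 / 2) ^+ 2.
Let c := L - a.

Lemma param_a_gt0 : 0 < a. Proof. by have := al_ge; rewrite /a; nra. Qed.

Lemma param_L_gt0 : 0 < L.
Proof. by rewrite exprn_gt0//; move: k_ge6 al_ge; lra. Qed.

Let cE : c = k ^+ 2 + 2 * k * al + k + al + 1 / 2.
Proof. by rewrite /c /L /a; field. Qed.

(** [c] increases with [k] and equals this affine function at [k = 6]. *)
Lemma param_c_ge : 13 * al + 85 / 2 <= c.
Proof. by have := al_ge; have := k_ge6; rewrite cE; nra. Qed.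

Lemma param_c_gt0 : 0 < c.
Proof. by have := param_c_ge; move: al_ge; lra. Qed.

(** [y] fixes the starting point by [cos t1 ^+ 2 = (c - y) / L], just inside the turning point
    [c / L]; then [b t1 = L * y / (a + y)]. *)
Variable y : R.
Hypothesis y_gt0 : 0 < y.
(* The factor [7 / 5] lies below [16 / 9 * (1 - 21 / 100)], which gives
   [param_y_small], and is large enough for [param_growth]. *)
Hypothesis yE : y ^+ 3 * L = 7 / 5 * a ^+ 2 * c.

Let L_ge : al ^+ 2 <= L. Proof. by have := al_ge; have := k_ge6; rewrite /L;
  nra. Qed.

Lemma param_y_le : y <= 21 / 100 * c.
Proof.
have a0 := param_a_gt0; have c0 := param_c_gt0; have L0 := param_L_gt0.
apply: ler_cube; first by rewrite mulr_ge0 ?(ltW c0).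
rewrite -(ler_pM2r L0) yE.
(* [169] is [13 ^+ 2], from [13 * al <= c]; it suffices because [7 / 5 <= 169 * (21 / 100) ^+ 3]. *)
have h : a ^+ 2 * 169 <= c ^+ 2 * L.
  have h1 : a ^+ 2 <= al ^+ 2 * L.
    rewrite expr2 ler_pM ?(ltW a0)//; first by rewrite /a; lra.
    by apply: le_trans L_ge; rewrite /a; lra.
  have h2 : (13 * al) ^+ 2 <= c ^+ 2.
    have al0 : 0 <= al by move: al_ge; lra.
    rewrite ler_pXn2r ?nnegrE ?(ltW c0) ?mulr_ge0//.
    by apply: le_trans param_c_ge; lra.
  have h3 : (13 * al) ^+ 2 * L <= c ^+ 2 * L by rewrite ler_wpM2r ?(ltW L0).
  move: h1 h3; rewrite exprMn; lra.
have := ler_wpM2r (ltW c0) h; nra.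
Qed.

(** The condition [bt1_small], squared and cleared of denominators. *)
Lemma param_y_small : y ^+ 3 * L < 16 / 9 * a ^+ 2 * (c - y).
Proof.
rewrite yE; have := param_y_le; have := param_c_gt0.
have : 0 < a ^+ 2 by rewrite exprn_gt0// param_a_gt0.
move: (a ^+ 2) => A2; nra.
Qed.

(** The condition [n1_large] multiplied by [L ^+ 3], for [e] the minimum of [a] and [9 / 10 * y].
    When [e = a], [A = 1] and [f] is constant; otherwise [e + y = 19 / 10 * y] and the definition of
    [y] decides. *)
Lemma param_growth (e : R) : e = a /\ a <= 9 / 10 * y \/ e = 9 / 10 * y /\ e <=
  a ->
  3 * (c + e) * (a - e) * (e + y) + 15 / 4 * (c + e) * (a - e) ^+ 2
    <= (L * e + (a - e)) * (e + y) ^+ 2.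
Proof.
have L0 := param_L_gt0; have c0 := param_c_gt0; have a0 := param_a_gt0.
case=> [[-> ay]|[-> ya]].
  rewrite subrr expr0n/= !(mulr0, mul0r, addr0).
  by rewrite mulr_ge0 ?sqr_ge0// mulr_ge0// ltW.
have yc := param_y_le.
have h1 : (c + 9 / 10 * y) * (15 / 4 * a ^+ 2) <= 9 / 10 * y * (19 / 10 * y) ^+
  2 * L.
  have -> : 9 / 10 * y * (19 / 10 * y) ^+ 2 * L = 3249 / 1000 * (y ^+ 3 * L)
    by field.
  rewrite yE; have : 0 < a ^+ 2 by rewrite exprn_gt0.
  move: (a ^+ 2) => A2; nra.
have h2 : 3 * (a - 9 / 10 * y) * (9 / 10 * y + y) + 15 / 4 * (a - 9 / 10 * y) ^+
  2
    <= 15 / 4 * a ^+ 2.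
  have h : 0 <= a * y by rewrite mulr_ge0 ?ltW.
  by move: h (sqr_ge0 y); lra.
have h3 : 0 <= (a - 9 / 10 * y) * (9 / 10 * y + y) ^+ 2.
  by rewrite mulr_ge0 ?sqr_ge0// subr_ge0.
have h4 : 0 <= c + 9 / 10 * y by rewrite addr_ge0 ?mulr_ge0 ?ltW.
have := ler_wpM2l h4 h2; move: h1 h3; lra.
Qed.

Variable T : R.
Hypothesis T_gt0 : 0 < T.
Hypothesis TE : T ^+ 6 = al ^+ 2 * (1 + al / k).

(** For [h = a / y], [h ^+ 3 = 5 / 7 * a * L / c] is least in the limit [L / c = 1], giving [h0]. As
    [(1 + h) / h] decreases in [h], a bound on [1 + h0] by [C * g] transfers to [1 + h] once
    [g * h <= T ^+ 2 * h0] absorbs the dependence on [k]. *)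
Lemma param_range (q C gl : R) : 0 < q ->
  31 / 10 * a <= q ^+ 3 * (al + 13 / 2) * (13 * al + 85 / 2) ->
  0 < gl -> gl ^+ 3 <= al ^+ 2 ->
  (forall g, gl <= g -> 1 <= C * g /\ 5 / 7 * (g ^+ 3 - 1 / 4) < (C * g - 1) ^+
    3) ->
  19 / 10 * y <= q ^+ 2 * c /\ 1 + a / y < C * T ^+ 2.
Proof.
move=> q0 qa gl0 gla Cg.
have L0 := param_L_gt0; have c0 := param_c_gt0; have a0 := param_a_gt0.
have k0 : 0 < k by move: k_ge6; lra.
have al0 : 0 < al by move: al_ge; lra.
split.
  apply: ler_cube; first by rewrite mulr_ge0 ?sqr_ge0 ?ltW.
  rewrite -(ler_pM2r L0) [in leLHS]exprMn -[leLHS]mulrA yE.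
  have lam : al + 13 / 2 <= k + al + 1 / 2 by move: k_ge6; lra.
  (* [(31 / 10) ^+ 2] is just above [(19 / 10) ^+ 3 * (7 / 5)]. *)
  have h1 : (31 / 10 * a) ^+ 2 <= (q ^+ 3 * (k + al + 1 / 2) * c) ^+ 2.
    have q3 : 0 <= q ^+ 3 by rewrite exprn_ge0 ?(ltW q0).
    have lam0 : 0 <= al + 13 / 2 by move: al0; lra.
    have lam1 : 0 <= k + al + 1 / 2 := le_trans lam0 lam.
    have n1 : 0 <= 31 / 10 * a by rewrite mulr_ge0 ?(ltW a0).
    have n2 : 0 <= q ^+ 3 * (k + al + 1 / 2) * c.
      by rewrite mulr_ge0 ?(ltW c0)// mulr_ge0.
    rewrite ler_pXn2r ?nnegrE//; apply: le_trans qa _.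
    have n3 : 0 <= 13 * al + 85 / 2 by move: al0; lra.
    by apply: ler_pM; rewrite ?param_c_ge ?ler_wpM2l// mulr_ge0.
  have -> : (q ^+ 2 * c) ^+ 3 * L = (q ^+ 3 * (k + al + 1 / 2) * c) ^+ 2 * c.
    by rewrite /L; ring.
  apply: le_trans (ler_wpM2r (ltW c0) h1).
  have : 0 <= a ^+ 2 * c by rewrite mulr_ge0 ?sqr_ge0 ?ltW.
  by rewrite [(31 / 10 * a) ^+ 2]exprMn; move: (a ^+ 2) => A2; lra.
have [h0 h00 h0E] : exists2 h0 : R, 0 < h0 & h0 ^+ 3 = 5 / 7 * a.
  by apply: cube_root; rewrite mulr_gt0.
have [g g0 gE] : exists2 g : R, 0 < g & g ^+ 3 = al ^+ 2.
  by apply: cube_root; rewrite exprn_gt0.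
have glg : gl <= g by apply: ler_cube; rewrite ?(ltW g0)// gE.
have [Cg1 Cg3] := Cg _ glg.
have h0C : 1 + h0 < C * g.
  rewrite ltNge; apply/negP => h.
  have : (C * g - 1) ^+ 3 <= h0 ^+ 3.
    by rewrite ler_pXn2r ?nnegrE ?subr_ge0// ?(ltW h00)//; lra.
  by move: Cg3; rewrite h0E gE /a; lra.
set h := a / y.
have h_gt0 : 0 < h by rewrite divr_gt0.
have hE : h ^+ 3 * c = 5 / 7 * a * L.
  rewrite /h; apply: (@mulIf _ (7 / 5 * a ^+ 2 * y ^+ 3)).
    by rewrite !mulf_neq0 ?expf_neq0 ?gt_eqF.
  have -> : (a / y) ^+ 3 * c * (7 / 5 * a ^+ 2 * y ^+ 3) = a ^+ 3 *
    (7 / 5 * a ^+ 2 * c).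
    by field; rewrite gt_eqF.
  by rewrite -yE; field.
have h0h : h0 <= h.
  apply: ler_cube; first exact: ltW.
  rewrite -(ler_pM2r c0) hE h0E ler_wpM2l ?mulr_ge0 ?(ltW a0)//.
  by rewrite /c; move: a0; lra.
have gT : g * h <= T ^+ 2 * h0.
  apply: ler_cube; first by rewrite mulr_ge0 ?sqr_ge0 ?ltW.
  rewrite [(g * h) ^+ 3]exprMn [(T ^+ 2 * h0) ^+ 3]exprMn -exprM TE gE h0E
    -(ler_pM2r c0) -[leLHS]mulrA hE.
  have : L <= (1 + al / k) * c.
    have -> : (1 + al / k) * c = c + al / k * c by ring.
    have h1 : k * al <= c by rewrite cE; nra.
    have : al / k * (k * al) <= al / k * c by rewrite ler_wpM2l// divr_ge0 ?ltW.
    have -> : al / k * (k * al) = al ^+ 2 by field; rewrite gt_eqF.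
    by rewrite /c /a; lra.
  have P0 : 0 <= al ^+ 2 * (5 / 7 * a) by rewrite mulr_ge0 ?sqr_ge0// mulr_ge0
    ?(ltW a0).
  move/(ler_wpM2l P0); lra.
have C0 : 0 < C.
  by rewrite -(pmulr_lgt0 _ g0); move: Cg1; lra.
rewrite -(ltr_pM2r h00).
have h1 : (1 + h) * h0 <= (1 + h0) * h by move: h0h; lra.
have h2 : (1 + h0) * h < C * g * h by rewrite ltr_pM2r.
have h3 : C * (g * h) <= C * (T ^+ 2 * h0) by rewrite ler_pM2l.
move: h1 h2 h3; lra.
Qed.


(** The condition for all [g >= gl] is a comparison of cubics in [t = g - gl]; the numerical
    conditions [c0] to [c3] compare them coefficient by coefficient. *)
Lemma param_range_final (q C gl : R) : 0 < q ->
  31 / 10 * a <= q ^+ 3 * (al + 13 / 2) * (13 * al + 85 / 2) ->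
  gl ^+ 3 <= al ^+ 2 ->
  [/\ 0 < gl, 1 <= C * gl, 5 / 7 * (gl ^+ 3 - 1 / 4) < (C * gl - 1) ^+ 3,
    5 / 7 * gl ^+ 2 <= C * (C * gl - 1) ^+ 2 &
    5 / 7 * gl <= C ^+ 2 * (C * gl - 1)] -> 5 / 7 <= C ^+ 3 ->
  C * (19 / 10) * (2 + 9 / 19 * q ^+ 2 + q) ^+ 2
    <= 900 / 49 * (1 - 10 / 19 * q ^+ 2) ->
  exists2 q : R, 0 < q /\ 19 / 10 * y <= q ^+ 2 * c &
    19 / 10 * (1 + a / y) * (2 + 9 / 19 * q ^+ 2 + q) ^+ 2
      < 900 / 49 * (1 - 10 / 19 * q ^+ 2) * T ^+ 2.
Proof.
have T2 : 0 < T ^+ 2 by rewrite exprn_gt0.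
move=> q0 qa gla [gl0 Cgl c0 c1 c2] c3 Cq.
have [g glg|yq aT] := @param_range q C gl q0 qa gl0 gla.
  have C0 : 0 < C by rewrite -(pmulr_lgt0 _ gl0); lra.
  have [t [t0 ->]] : exists t, 0 <= t /\ g = gl + t.
    by exists (g - gl); rewrite subr_ge0 glg addrC subrK.
  split; first by rewrite mulrDr; have := mulr_ge0 (ltW C0) t0; lra.
  have t2 : 0 <= t ^+ 2 := sqr_ge0 t.
  have t3 : 0 <= t ^+ 3 by rewrite exprn_ge0.
  have := ler_wpM2r t0 c1; have := ler_wpM2r t2 c2; have := ler_wpM2r t3 c3.
  by move: c0; lra.
exists q => //; set X := (2 + _ + q) ^+ 2 in Cq *.
have X0 : 0 < X by rewrite exprn_gt0// addr_gt0// addr_gt0// mulr_gt0//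
  exprn_gt0.
have h1 : 19 / 10 * (1 + a / y) * X < 19 / 10 * (C * T ^+ 2) * X.
  by rewrite ltr_pM2r// ltr_pM2l.
have := ler_wpM2r (ltW T2) Cq; move: h1; lra.
Qed.

Lemma param_final : exists2 q : R, 0 < q /\ 19 / 10 * y <= q ^+ 2 * c &
  19 / 10 * (1 + a / y) * (2 + 9 / 19 * q ^+ 2 + q) ^+ 2
    < 900 / 49 * (1 - 10 / 19 * q ^+ 2) * T ^+ 2.
Proof.
have [q [C [gl [q0 qa gla glC [C3 Cq]]]]] := range_cover al_ge.
exact: (@param_range_final q C gl).
Qed.

(** The last premise is the square of the amplitude bound. If [10 / 7 * T <= S], bounding each of
    its factors through [q] contradicts [param_final], where [900 / 49 = 9 * (10 / 7) ^+ 2]. *)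
Lemma param_conclusion (S e m r : R) : 0 <= e -> e <= 9 / 10 * y ->
  0 <= m -> 0 <= r -> m ^+ 2 = (c + e) / L -> r ^+ 2 = (e + y) / L ->
  9 * S ^+ 2 * y ^+ 2 * (c - y) <= (a + y) * (e + y) * (L * (2 * m + r) ^+ 2) ->
  S < 10 / 7 * T.
Proof.
move=> e0 ey m0 r0 mE rE hS.
have L0 := param_L_gt0; have c0 := param_c_gt0; have a0 := param_a_gt0.
have [q [q0 yq] hT] := param_final.
have y21 := param_y_le.
rewrite ltNge; apply/negP => TS.
pose X := 2 + 9 / 19 * q ^+ 2 + q.
have q2 : 0 <= q ^+ 2 := sqr_ge0 q.
have X0 : 0 <= X by rewrite /X; lra.
have hX : L * (2 * m + r) ^+ 2 <= c * X ^+ 2.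
  have sL : Num.sqrt L ^+ 2 = L by rewrite sqr_sqrtr// ltW.
  have sc : Num.sqrt c ^+ 2 = c by rewrite sqr_sqrtr// ltW.
  have sL0 := sqrtr_ge0 L; have sc0 := sqrtr_ge0 c.
  have n1 : 0 <= Num.sqrt L * (2 * m + r).
    by rewrite mulr_ge0 ?addr_ge0 ?mulr_ge0.
  have n2 : 0 <= Num.sqrt c * X by rewrite mulr_ge0.
  rewrite -{1}sL -{1}sc -!exprMn ler_pXn2r ?nnegrE//.
  (* From [L * m ^+ 2 = c + e <= c * (1 + 9 / 19 * q ^+ 2)] and [sqrt (1 + z) <= 1 + z / 2]. *)
  have hm : Num.sqrt L * m <= Num.sqrt c * (1 + 9 / 38 * q ^+ 2).
    have n3 : 0 <= 1 + 9 / 38 * q ^+ 2 by lra.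
    rewrite -(@ler_pXn2r _ 2) ?nnegrE ?mulr_ge0//.
    rewrite !exprMn sL sc mE mulrCA divff ?gt_eqF// mulr1.
    have : 0 <= c * (9 / 38 * q ^+ 2) ^+ 2 by rewrite mulr_ge0 ?sqr_ge0
      ?(ltW c0).
    by move: yq ey; lra.
  have hr : Num.sqrt L * r <= Num.sqrt c * q.
    rewrite -(@ler_pXn2r _ 2) ?nnegrE ?mulr_ge0 ?(ltW q0)//.
    rewrite !exprMn sL sc rE mulrCA divff ?gt_eqF// mulr1.
    by move: yq ey; lra.
  by rewrite /X; move: hm hr; lra.
have ay : (a + y) * (e + y) <= 19 / 10 * (1 + a / y) * y ^+ 2.
  have -> : 19 / 10 * (1 + a / y) * y ^+ 2 = (a + y) * (19 / 10 * y).
    by field; rewrite gt_eqF.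
  by rewrite ler_wpM2l//; [rewrite addr_ge0 ?ltW|lra].
have cy : c * (1 - 10 / 19 * q ^+ 2) <= c - y by move: yq; lra.
have cy0 : 0 <= c - y by move: c0 y21; lra.
have ST : 100 / 49 * T ^+ 2 <= S ^+ 2.
  have -> : 100 / 49 * T ^+ 2 = (10 / 7 * T) ^+ 2 by field.
  have T0 := ltW T_gt0.
  by rewrite ler_pXn2r ?nnegrE ?(le_trans _ TS) ?mulr_ge0.
have y2 : 0 < y ^+ 2 by rewrite exprn_gt0.
have h1 : 900 / 49 * T ^+ 2 * (c * (1 - 10 / 19 * q ^+ 2)) <= 9 * S ^+ 2 *
  (c - y).
  apply: (@le_trans _ _ (900 / 49 * T ^+ 2 * (c - y))).
    have T9 : 0 <= 900 / 49 * T ^+ 2.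
      by apply: mulr_ge0; [lra|exact: sqr_ge0].
    exact: (ler_wpM2l T9 cy).
  have T9 : 900 / 49 * T ^+ 2 <= 9 * S ^+ 2 by lra.
  exact: (ler_wpM2r cy0 T9).
have h2 : 9 * S ^+ 2 * (c - y) * y ^+ 2
    <= 19 / 10 * (1 + a / y) * y ^+ 2 * (c * X ^+ 2).
  apply: le_trans (ler_pM _ _ ay hX); first by move: hS; lra.
    by apply: mulr_ge0; apply: addr_ge0; rewrite // ltW.
  by rewrite mulr_ge0 ?sqr_ge0 ?(ltW L0).
have h3 : 9 * S ^+ 2 * (c - y) <= 19 / 10 * (1 + a / y) * (c * X ^+ 2).
  by rewrite -(ler_pM2r y2); move: h2; lra.
have h4 : 19 / 10 * (1 + a / y) * X ^+ 2 * c
    < 900 / 49 * (1 - 10 / 19 * q ^+ 2) * T ^+ 2 * c by rewrite ltr_pM2r.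
by move: h1 h3 h4; lra.
Qed.

End Estimates.

(** * Conclusion *)

Section LiouvilleForm.
Variable R : realType.
Variable alpha : R.
Hypothesis alpha_gt : 1 / 2 < alpha.
Variable p : {poly R}.
Variable K : R.
Hypothesis ode : forall x : R, (1 - x ^+ 2) * p^`()^`().[x] =
  2 * (alpha + 1) * x * p^`().[x] - K * p.[x].
Let a : R := alpha ^+ 2 - 1 / 4.
Let L : R := K + (alpha + 1 / 2) ^+ 2.

Definition liouville (t : R) : R := sin t `^ (alpha + 1 / 2) * p.[cos t].

Definition liouville_deriv (t : R) : R := sin t `^ (alpha + 1 / 2)
  * ((alpha + 1 / 2) * (cos t / sin t) * p.[cos t] - sin t * p^`().[cos t]).

Let g : R := alpha + 1 / 2.
Let g0 : 0 < g. Proof. by have := alpha_gt; rewrite /g; lra. Qed.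

Let dW (t : R) : 0 < sin t ->
  is_derive t 1 (fun t : R => sin t `^ g) (g * (cos t / sin t) * sin t `^ g).
Proof.
move=> st.
have D : is_derive (sin t) 1 (fun y => y `^ g) (g * sin t `^ (g - 1)).
  exact: is_derive1_powR.
have := @is_derive1_chain _ (fun y => y `^ g) (@sin R) t _ _ D
  (is_derive_sin t).
rewrite powRB; last by rewrite (gt_eqF st) implybT.
rewrite powRr1 ?(ltW st)// => H; eapply is_derive_eq; first exact: H.
by field; rewrite gt_eqF.
Qed.

Lemma is_derive_liouville (t : R) : 0 < sin t ->
  is_derive t 1 liouville (liouville_deriv t).
Proof.
move=> st; have := dW st => ?.
rewrite /liouville -/g; eapply is_derive_eq; first by der.
by rewrite /liouville_deriv -/g /=; ring.
Qed.

Lemma is_derive_liouville_deriv (t : R) : 0 < sin t ->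
  is_derive t 1 liouville_deriv (- (L - a / sin t ^+ 2) * liouville t).
Proof.
move=> st; have := dW st => ?.
rewrite /liouville_deriv -/g; eapply is_derive_eq; first by der;
  rewrite /= gt_eqF.
rewrite /liouville -/g /=.
have := ode (cos t); have c2 := cos2sin2 t.
set W := sin t `^ g; set p2 := p^`()^`().[_]; set p1 := p^`().[_];
  set p0 := p.[_].
move: st c2; set s := sin t; set c := cos t => st c2 E.
apply/eqP; rewrite -subr_eq0.
(* The difference is a combination of the differential equation at [cos t] and of
   [cos ^ 2 + sin ^ 2 = 1]. *)
rewrite (_ : _ - _ = W * ((1 - c ^+ 2) * p2
  - (2 * (alpha + 1) * c * p1 - K * p0))
  + W * (p2 + a * p0 / s ^+ 2) * (c ^+ 2 - (1 - s ^+ 2))).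
  by rewrite E subrr mulr0 c2 subrr mulr0 addr0.
by rewrite /L /a /g; field; rewrite gt_eqF.
Qed.

Let sin_ge0 (t : R) : 0 <= t <= pi / 2 -> 0 <= sin t.
Proof.
by move=> /andP[t0 t1]; apply: sin_ge0_pi; rewrite t0/=; have := pi_gt0 R; lra.
Qed.

Let continuous_sin_powR (r : R) : 0 < r -> continuous
  (fun t : R => (Num.max (sin t) 0) `^ r).
Proof.
move=> r0 t.
apply: (@continuous_comp _ _ _ (@sin R) (fun y : R => (Num.max y 0) `^ r)).
  exact: continuous_sin.
exact: continuous_max0_powR.
Qed.

Lemma liouville_continuous : {within [set` `[0 : R, pi / 2]], continuous
  liouville}.
Proof.
apply: (@subspace_eq_continuous _ _ _
  (fun t : R => (Num.max (sin t) 0) `^ g * p.[cos t])).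
  move=> t /set_mem/=; rewrite in_itv/= => ht.
  by rewrite max_l ?sin_ge0.
apply: continuous_subspaceT => t; apply: cvgM.
  exact: continuous_sin_powR.
apply: (@continuous_comp _ _ _ (@cos R) (horner p)).
  exact: continuous_cos.
exact: continuous_horner.
Qed.

Lemma liouville0 : liouville 0 = 0.
Proof. by rewrite /liouville sin0 powR0 ?gt_eqF// mul0r. Qed.

Let E (t : R) : R := liouville_deriv t ^+ 2 + (L - a / sin t ^+ 2) * liouville t
  ^+ 2.

Lemma liouville_energy0 : E 0 = 0.
Proof.
by rewrite /E liouville0 /liouville_deriv sin0 powR0 ?gt_eqF// mul0r expr0n
  mulr0 addr0.
Qed.

(** The poles at 0 are absorbed by the powers of the sine: [E] is [sin ^ (2 * alpha - 1)] times the
    smooth function [Q], and the exponent is positive because [alpha > 1 / 2]. *)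
Lemma liouville_energy_continuous :
  {within [set` `[0 : R, pi / 2]], continuous E}.
Proof.
have r0 : 0 < 2 * alpha - 1 by have := alpha_gt; lra.
pose Q (t : R) := (g * (cos t * p.[cos t]) - sin t ^+ 2 * p^`().[cos t]) ^+ 2
  + (L * sin t ^+ 2 - a) * p.[cos t] ^+ 2.
apply: (@subspace_eq_continuous _ _ _
  (fun t : R => (Num.max (sin t) 0) `^ (2 * alpha - 1) * Q t)).
  move=> t /set_mem/=; rewrite in_itv/= => ht.
  rewrite max_l ?sin_ge0// /from_subspace /E.
  have := sin_ge0 ht; rewrite le_eqVlt => /predU1P[s0|s0].
    rewrite /liouville_deriv /liouville -s0 !powR0 ?gt_eqF//.
    by rewrite !mul0r expr0n/= mulr0 addr0.
  have W2 : (sin t `^ g) ^+ 2 = sin t `^ (2 * alpha - 1) * sin t ^+ 2.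
    rewrite -powR_mulrn ?powR_ge0// -powRrM -[in RHS]powR_mulrn ?(ltW s0)//.
    rewrite -powRD; last by rewrite (gt_eqF s0) implybT.
    by congr (_ `^ _); rewrite /g; field.
  rewrite /liouville_deriv /liouville -/g ![(sin t `^ g * _) ^+ 2]exprMn W2 /Q.
  by field; rewrite gt_eqF.
apply: continuous_subspaceT => t; apply: cvgM.
  exact: continuous_sin_powR.
eapply is_derive1_continuous; rewrite /Q; der.
Qed.

Lemma liouville_sqr (t : R) : 0 <= sin t ->
  liouville t ^+ 2 = sin t * ultraspherical_weight alpha (cos t) * p.[cos t] ^+
    2.
Proof.
move=> s0; rewrite /liouville /ultraspherical_weight -sin2cos2 exprMn.
congr (_ * _).
have al0 : 0 < alpha by have := alpha_gt; lra.
rewrite powRD; last by rewrite gt_eqF// -/g.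
rewrite exprMn div1r powR12_sqrt// sqr_sqrtr// mulrC.
by rewrite [sin t ^+ 2]expr2 powRM// expr2.
Qed.

End LiouvilleForm.

(** * Orthonormality as a bound on the integral of [v ^+ 2] *)

Section Mass.
Variable R : realType.
Variable alpha : R.
Hypothesis alpha_gt0 : 0 < alpha.
Notation mu := (@lebesgue_measure R).
Variable p : {poly R}.
Hypothesis p_even : forall x : R, p.[- x] ^+ 2 = p.[x] ^+ 2.
Hypothesis p_norm : weight_int alpha (p * p) = 1.

Let G (x : R) : R := (Num.max (1 - x ^+ 2) 0) `^ alpha * (p * p).[x].
Let F (x : R) : R := (\int[mu]_(t in [set` `[(- 1 : R), x]]) G t)%R.

Let G_ge0 x : 0 <= G x.
Proof. by rewrite /G hornerM -expr2 mulr_ge0 ?sqr_ge0 ?powR_ge0. Qed.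

Let G_even x : G (- x) = G x.
Proof. by rewrite /G !hornerM -!expr2 sqrrN p_even. Qed.

Let Gc : continuous G.
Proof. exact: continuous_max0_powR_horner. Qed.

Let Gint (x y : R) : mu.-integrable [set` `[x, y]] (EFin \o G).
Proof.
apply: continuous_compact_integrable; first exact: segment_compact.
exact: continuous_subspaceT.
Qed.

Let F1 : F 1 = 1.
Proof.
rewrite /F -[RHS]p_norm; apply: eq_Rintegral => x.
by rewrite inE/= in_itv/= => hx; rewrite /G weight_max0.
Qed.

Let F_ge0 x : 0 <= F x.
Proof. by apply: Rintegral_ge0 => t _. Qed.

Let F_le1 x : x <= 1 -> F x <= 1.
Proof.
move=> x1; rewrite -[leRHS]F1; apply: fine_le; try exact: integrable_fin_num.
apply: ge0_subset_integral => //.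
- by have /integrableP[] := Gint (- 1) 1.
- by move=> t _; rewrite lee_fin.
- by apply: subset_itvl; rewrite bnd_simp.
Qed.

Let dF (x : R) : -1 < x < 1 -> is_derive x 1 F (G x).
Proof.
move=> /andP[x0 x1].
have [d1 d2] := continuous_FTC1_closed x1 (@Gint _ _) x0 (@Gc x).
by apply: DeriveDef; [exact: d1|rewrite -derive1E].
Qed.

(** By evenness this is the integral of [v ^+ 2] from [t] to [pi / 2]. The symmetric difference
    makes it vanish at [pi / 2] and stay below half the total mass. *)
Definition half_mass (t : R) : R := (F (cos t) - F (- cos t)) / 2.

Lemma half_mass_le t : half_mass t <= 1 / 2.
Proof.
by have := F_ge0 (- cos t); have := F_le1 (cos_le1 t); rewrite /half_mass; lra.
Qed.

Lemma half_mass_mid : half_mass (pi / 2) = 0.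
Proof. by rewrite /half_mass cos_pihalf oppr0 subrr mul0r. Qed.

Lemma is_derive_half_mass t : 0 < sin t ->
  is_derive t 1 half_mass
    (- (sin t * ultraspherical_weight alpha (cos t) * p.[cos t] ^+ 2)).
Proof.
move=> st; have c1 : -1 < cos t < 1.
  have : 0 < sin t ^+ 2 by rewrite exprn_gt0.
  by rewrite sin2cos2 => h; nra.
have c2 : -1 < - cos t < 1 by rewrite ltrNl opprK ltrNl andbC.
have D1 : is_derive t 1 (fun t : R => F (cos t)) (G (cos t) * - sin t).
  exact: (@is_derive1_chain _ F (@cos R) t _ _ (dF c1) (is_derive_cos t)).
have D2 : is_derive t 1 (fun t : R => F (- cos t)) (G (- cos t) * - - sin t).
  have Dc : is_derive t 1 (fun t : R => - cos t) (- - sin t).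
    exact: (@is_derive1N _ (@cos R) _ _ (is_derive_cos t)).
  exact: (@is_derive1_chain _ F (fun t => - cos t) t _ _ (dF c2) Dc).
rewrite /half_mass; eapply is_derive_eq; first by der.
rewrite /= G_even /G -weight_max0; last by rewrite cos_geN1 cos_le1.
by rewrite hornerM; field.
Qed.

End Mass.

(** * Choice of the parameters and the bound on the half interval *)

Section Main.
Variable R : realType.
Variable alpha : R.
Hypothesis halpha : (1 + Num.sqrt 2) / 4 <= alpha.
Variables (P : nat -> {poly R}) (k : nat).
Hypothesis hP : orthonormal_ultraspherical alpha P.
Hypothesis hk : (6 <= k)%N.

Let al_ge : 1207 / 2000 <= alpha.
Proof.
have s2 : Num.sqrt 2 ^+ 2 = 2 :> R by rewrite sqr_sqrtr.
have := sqrtr_ge0 (2 : R); move: s2 halpha.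
move: (Num.sqrt 2 : R) => s s2 hs s0.
(* [(1 + 707 / 500) / 4 = 1207 / 2000]. *)
have : 707 / 500 <= s by nra.
by move: hs; lra.
Qed.

Let al0 : 0 < alpha. Proof. by have := al_ge; lra. Qed.
Let al12 : 1 / 2 < alpha. Proof. by have := al_ge; lra. Qed.
Let k6 : 6 <= k%:R :> R. Proof. by rewrite ler_nat. Qed.

Let p := P k.
Let a : R := alpha ^+ 2 - 1 / 4.
Let L : R := (k%:R + alpha + 1 / 2) ^+ 2.
Let c : R := L - a.
Let K : R := k%:R * (k%:R + 2 * alpha + 1).
Let v := liouville alpha p.
Let u := liouville_deriv alpha p.

Let p_even (x : R) : p.[- x] ^+ 2 = p.[x] ^+ 2.
Proof. by rewrite (ultraspherical_parity al0 hP) exprMn sqrr_sign mul1r. Qed.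

Let p_norm : weight_int alpha (p * p) = 1.
Proof.
have [_ /(_ k k)] := hP => h; apply/EFin_inj; rewrite -weight_intE//.
rewrite eqxx in h; rewrite -[RHS]h.
by apply: eq_integral => x _; rewrite hornerM mulrA.
Qed.

Let Phi := half_mass alpha p.

Let ode (x : R) := ultraspherical_ode_horner al0 hP k x.

Let LE : K + (alpha + 1 / 2) ^+ 2 = L.
Proof. by rewrite /K /L; field. Qed.

Let sin_gt0 (t : R) : 0 < t <= pi / 2 -> 0 < sin t.
Proof.
move=> /andP[t0 t1]; apply: sin_gt0_pi; rewrite t0/=.
by have := pi_gt0 R; lra.
Qed.

Let dv (t : R) : 0 < t <= pi / 2 -> is_derive t 1 v (u t).
Proof. by move=> /sin_gt0; exact: is_derive_liouville. Qed.

Let du (t : R) : 0 < t <= pi / 2 ->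
  is_derive t 1 u (- (L - a / sin t ^+ 2) * v t).
Proof.
by move=> /sin_gt0 st; rewrite -LE; apply: is_derive_liouville_deriv.
Qed.

Let dPhi (t : R) : 0 < t <= pi / 2 -> is_derive t 1 Phi (- v t ^+ 2).
Proof.
move=> /sin_gt0 st; rewrite /v liouville_sqr ?(ltW st)//.
exact: is_derive_half_mass.
Qed.

Let vu_mid : v (pi / 2) * u (pi / 2) = 0.
Proof.
rewrite /v /u /liouville /liouville_deriv sin_pihalf cos_pihalf powR1 !mul1r
  mul0r mulr0 mul0r sub0r.
by rewrite mulrN (ultraspherical_critical0 al0 hP) oppr0.
Qed.

Lemma sup_liouville (T : R) : 0 < T ->
  T ^+ 6 = alpha ^+ 2 * (1 + alpha / k%:R) ->
  forall t, 0 <= t <= pi / 2 -> v t ^+ 2 < 10 / 7 * T.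
Proof.
move=> T0 TE t ht.
have a0 : 0 < a := param_a_gt0 al_ge.
have L0 : 0 < L := param_L_gt0 k6 al_ge.
have c0 : 0 < c := param_c_gt0 k6 al_ge.
have [y y0 yE] : exists2 y : R, 0 < y & y ^+ 3 = 7 / 5 * a ^+ 2 * c / L.
  by apply: cube_root; rewrite divr_gt0// mulr_gt0// mulr_gt0// exprn_gt0.
have {}yE : y ^+ 3 * L = 7 / 5 * a ^+ 2 * c by rewrite yE divfK// gt_eqF.
have yc : y <= 21 / 100 * c := param_y_le k6 al_ge yE.
have cy : 0 < c - y by lra.
have [e he] : exists e, e = a /\ a <= 9 / 10 * y \/ e = 9 / 10 * y /\ e <= a.
  have [ay|ya] := leP a (9 / 10 * y); first by exists a; left.
  by exists (9 / 10 * y); right; rewrite ltW.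
have e0 : 0 < e by case: he => [[-> _]|[-> _]]//; lra.
have ea : e <= a by case: he => [[-> _]|[-> +]].
have ey : e <= 9 / 10 * y by case: he => [[-> +]|[-> _]].
pose X := (c - y) / L.
have X0 : 0 < X by rewrite divr_gt0.
have X1 : X < 1 by rewrite ltr_pdivrMr// mul1r /c; lra.
pose x1 := Num.sqrt X.
have x10 : 0 < x1 by rewrite sqrtr_gt0.
have x1E : x1 ^+ 2 = X by rewrite sqr_sqrtr// ltW.
have x11 : x1 < 1 by rewrite -(@ltr_pXn2r _ 2) ?nnegrE ?(ltW x10)// x1E expr1n.
pose t1 := acos x1.
have cost1 : cos t1 = x1 by rewrite acosK// in_itv/=; lra.
have t10 : 0 < t1 by apply: acos_gt0; lra.
have t1pi : t1 <= pi by apply: acos_lepi; lra.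
have t12 : t1 <= pi / 2.
  rewrite leNgt -ltr_cos ?in_itv/= ?cos_pihalf ?cost1 -?leNgt ?(ltW x10)
    ?(ltW t10)//.
  by have := pi_gt0 R; lra.
have ht1 : 0 < t1 <= pi / 2 by rewrite t10.
have s0 := sin_gt0 ht1.
have s2 : sin t1 ^+ 2 = (a + y) / L.
  rewrite sin2cos2 cost1 x1E /X /c; field; rewrite gt_eqF//.
have ay0 : 0 < a + y by rewrite addr_gt0.
have bE : L - a / sin t1 ^+ 2 = L * y / (a + y).
  by rewrite s2; field; rewrite !gt_eqF.
have b0 : 0 < L - a / sin t1 ^+ 2 by rewrite bE divr_gt0// mulr_gt0.
have bsmall : (L - a / sin t1 ^+ 2) * Num.sqrt (L - a / sin t1 ^+ 2)
    < 4 / 3 * a * cos t1 / sin t1 ^+ 3.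
  have n1 : 0 <= (L - a / sin t1 ^+ 2) * Num.sqrt (L - a / sin t1 ^+ 2).
    by rewrite mulr_ge0 ?sqrtr_ge0// ltW.
  have n2 : 0 <= 4 / 3 * a * cos t1 / sin t1 ^+ 3.
    rewrite cost1 divr_ge0 ?exprn_ge0 ?(ltW s0)//.
    by rewrite mulr_ge0 ?(ltW x10)// mulr_ge0// ltW.
  rewrite -(@ltr_pXn2r _ 2) ?nnegrE// exprMn sqr_sqrtr ?(ltW b0)//.
  have -> : (4 / 3 * a * cos t1 / sin t1 ^+ 3) ^+ 2 =
      16 / 9 * a ^+ 2 * X / (sin t1 ^+ 2) ^+ 3.
    by rewrite cost1 -x1E; field; rewrite gt_eqF.
  rewrite bE s2 /X.
  have -> : (L * y / (a + y)) ^+ 2 * (L * y / (a + y)) =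
      y ^+ 3 * L * (L ^+ 2 / (a + y) ^+ 3) by field; rewrite gt_eqF.
  have -> : 16 / 9 * a ^+ 2 * ((c - y) / L) / ((a + y) / L) ^+ 3 =
      16 / 9 * a ^+ 2 * (c - y) * (L ^+ 2 / (a + y) ^+ 3).
    by field; rewrite !gt_eqF.
  rewrite ltr_pM2r; last by apply: divr_gt0; apply: exprn_gt0.
  exact: (param_y_small k6 al_ge yE).
have v0 : v 0 = 0 by exact: liouville0.
have vc : {within [set` `[0 : R, pi / 2]], continuous v}
  by exact: liouville_continuous.
have E0 := liouville_energy0 al12 p K.
have Ec := liouville_energy_continuous al12 (p := p) (K := K).
rewrite LE in E0 Ec.
have vS := sqr_le_sonin a0 dv du v0 E0 vc Ec ht1 b0 bsmall ht.
have slope := slope_ge0_start a0 dv du v0 E0 vc Ec ht1 bsmall.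
apply: le_lt_trans vS _.
set S := v t1 ^+ 2 + _.
have S0 : 0 <= S by rewrite addr_ge0 ?sqr_ge0// divr_ge0 ?sqr_ge0// ltW.
(* The squared turning point is [c / L]; [A] exceeds it by [e / L], while [cos t1 ^+ 2] falls short
   of it by [y / L]. *)
pose A := (c + e) / L.
have A0 : 0 < A by rewrite divr_gt0// addr_gt0.
have A1 : A <= 1 by rewrite ler_pdivrMr// mul1r /c; lra.
have BE : 1 - A = (a - e) / L by rewrite /A /c; field; rewrite gt_eqF.
have nE : sin t1 ^+ 2 - (1 - A) = (e + y) / L.
  by rewrite s2 BE; field; rewrite gt_eqF.
have n0 : 0 < sin t1 ^+ 2 - (1 - A) by rewrite nE divr_gt0// addr_gt0.
have eE : L * A - L + a = e by rewrite /A /c; field; rewrite gt_eqF.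
have grow : 3 * A * (1 - A) * (sin t1 ^+ 2 - (1 - A)) + 15 / 4 * A * (1 - A) ^+
  2
    <= (L * A - L + a + (1 - A)) * (sin t1 ^+ 2 - (1 - A)) ^+ 2.
  rewrite eE nE BE /A.
  have -> : 3 * ((c + e) / L) * ((a - e) / L) * ((e + y) / L)
      + 15 / 4 * ((c + e) / L) * ((a - e) / L) ^+ 2 =
    (3 * (c + e) * (a - e) * (e + y) + 15 / 4 * (c + e) * (a - e) ^+ 2) / L ^+
      3.
    by field; rewrite gt_eqF.
  have -> : (e + (a - e) / L) * ((e + y) / L) ^+ 2 =
    (L * e + (a - e)) * (e + y) ^+ 2 / L ^+ 3 by field; rewrite gt_eqF.
  rewrite ler_pM2r; last by rewrite invr_gt0 exprn_gt0.
  exact: (param_growth k6 al_ge y0 yE he).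
have sub x : t1 <= x <= pi / 2 -> 0 < x <= pi / 2.
  by move=> /andP[tx ->]; rewrite (lt_le_trans t10 tx).
have dv1 x (hx : t1 <= x <= pi / 2) := dv (sub x hx).
have du1 x (hx : t1 <= x <= pi / 2) := du (sub x hx).
have dPhi1 x (hx : t1 <= x <= pi / 2) := dPhi (sub x hx).
have Phi_mid : Phi (pi / 2) = 0 by exact: half_mass_mid.
have Phi1 : Phi t1 <= 1 / 2 by exact: half_mass_le.
have := amplitude_bound A0 A1 ht1 n0 grow dv1 du1 slope b0 vu_mid dPhi1 Phi_mid
  Phi1 L0.
rewrite -/S cost1 bE; set m := Num.sqrt A; set r := Num.sqrt (_ - _).
have m0 : 0 < m by rewrite sqrtr_gt0.
have r0 : 0 < r by rewrite sqrtr_gt0.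
have mE : m ^+ 2 = (c + e) / L by rewrite sqr_sqrtr// ltW.
have rE : r ^+ 2 = (e + y) / L by rewrite sqr_sqrtr ?nE// -nE ltW.
move=> h; apply: (param_conclusion k6 al_ge y0 yE T0 TE (ltW e0) ey (ltW m0)
  (ltW r0) mE rE).
have {}h : S * (y * sin t1) * (3 * x1) <= r * (2 * m + r) * (a + y).
  rewrite -(ler_pM2l L0).
  have mr : 0 < 2 * m + r by rewrite addr_gt0// mulr_gt0.
  have -> : L * (S * (y * sin t1) * (3 * x1)) =
    (S * (L * y / (a + y) * sin t1 / r) * (3 * x1 / (2 * m + r)))
      * (r * (2 * m + r) * (a + y)) by field; rewrite !gt_eqF.
  apply: (ler_wpM2r _ h); apply: mulr_ge0; last exact: ltW.
  by rewrite mulr_ge0 ?ltW.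
(* After squaring, [sin t1], [x1] and the outer factor [r] enter through squares that are rational
   in the parameters. *)
have {}h : (S * (y * sin t1) * (3 * x1)) ^+ 2 <= (r * (2 * m + r) * (a + y)) ^+
  2.
  have n1 : 0 <= S * (y * sin t1) * (3 * x1).
    by apply: mulr_ge0; apply: mulr_ge0 => //; [apply: mulr_ge0|]; apply: ltW.
  have n2 : 0 <= r * (2 * m + r) * (a + y).
    apply: mulr_ge0; last exact: ltW.
    by apply: mulr_ge0; rewrite ?addr_ge0 ?mulr_ge0 ?ltW.
  by rewrite ler_pXn2r ?nnegrE.
have l1 : (S * (y * sin t1) * (3 * x1)) ^+ 2
    = 9 * S ^+ 2 * y ^+ 2 * (c - y) * ((a + y) / L ^+ 2).
  have -> : (S * (y * sin t1) * (3 * x1)) ^+ 2 =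
      9 * S ^+ 2 * y ^+ 2 * sin t1 ^+ 2 * x1 ^+ 2 by ring.
  by rewrite s2 x1E /X; field; rewrite gt_eqF.
have l2 : (r * (2 * m + r) * (a + y)) ^+ 2
    = (a + y) * (e + y) * (L * (2 * m + r) ^+ 2) * ((a + y) / L ^+ 2).
  have -> : (r * (2 * m + r) * (a + y)) ^+ 2 =
      r ^+ 2 * (2 * m + r) ^+ 2 * (a + y) ^+ 2 by ring.
  by rewrite rE; field; rewrite gt_eqF.
have aL : 0 < (a + y) / L ^+ 2 by apply: divr_gt0 => //; apply: exprn_gt0.
by move: h; rewrite l1 l2 (ler_pM2r aL).
Qed.

End Main.

Theorem theorem1 (R : realType) (alpha : R) (P : nat -> {poly R}) (k : nat)
    (hP : orthonormal_ultraspherical alpha P)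
    (hk : (6 <= k)%N)
    (halpha : (1 + Num.sqrt 2) / 4 <= alpha) :
  M_ultraspherical alpha (P k)
    < mu_parity R k * alpha `^ (1 / 3) * (1 + alpha / k%:R) `^ (1 / 6).
Proof.
have sq1 : 1 < Num.sqrt 2 :> R by rewrite -[X in X < _]sqrtr1 ltr_sqrt// ltr1n.
have al12 : 1 / 2 < alpha by move: halpha; lra.
have al0 : 0 < alpha by lra.
have k0 : 0 < k%:R :> R by rewrite ltr0n (leq_trans _ hk).
pose T := alpha `^ (1 / 3) * (1 + alpha / k%:R) `^ (1 / 6).
have z0 : 0 < 1 + alpha / k%:R by rewrite addr_gt0// divr_gt0.
have T0 : 0 < T by rewrite mulr_gt0// powR_gt0.
have TE : T ^+ 6 = alpha ^+ 2 * (1 + alpha / k%:R).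
  rewrite /T exprMn; congr (_ * _).
    rewrite -[LHS]powR_mulrn ?powR_ge0// -powRrM -[RHS]powR_mulrn ?(ltW al0)//.
    by congr (_ `^ _); field.
  rewrite -[LHS]powR_mulrn ?powR_ge0// -powRrM.
  have -> : 1 / 6 * 6%:R = 1 :> R by field.
  by rewrite powRr1// ltW.
(* The bound with [10 / 7] is proved for both parities, and [10 / 7 <= 22]. *)
apply: (@lt_le_trans _ _ (10 / 7 * T)); last first.
  rewrite -[leRHS]mulrA -/T ler_wpM2r ?(ltW T0)// /mu_parity.
  by case: ifP => _; lra.
(* The supremum is attained, so a strict pointwise bound stays strict. *)
have [x + [-> _]] := @M_ultraspherical_max R alpha (P k) ltac:(lra).
have even_case (z : R) : 0 <= z <= 1 ->
    Num.sqrt (1 - z ^+ 2) * ultraspherical_weight alpha z * (P k).[z] ^+ 2 < 10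
      / 7 * T.
  move=> /andP[z0' z1].
  have zc : cos (acos z) = z by rewrite acosK// in_itv/=; lra.
  have zs : sin (acos z) = Num.sqrt (1 - z ^+ 2) by rewrite sin_acos//; lra.
  have hz : 0 <= acos z <= pi / 2.
    rewrite acos_ge0/=; last by lra.
    rewrite leNgt -ltr_cos ?in_itv/= ?cos_pihalf ?zc -?leNgt ?acos_ge0
      ?acos_lepi//; try lra.
    by have := pi_gt0 R; lra.
  have := sup_liouville halpha hP hk T0 TE hz.
  by rewrite (liouville_sqr al12) ?zs ?sqrtr_ge0 ?zc.
rewrite in_itv/= => /andP[x0 x1].
have [xp|xn] := leP 0 x; first by apply: even_case; rewrite xp.
have := even_case (- x); rewrite /ultraspherical_weight sqrrN
  (ultraspherical_parity al0 hP) exprMn sqrr_sign mul1r.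
by apply; apply/andP; split; lra.
Qed.
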